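(* Let $k\ge 3$ be an integer. The integers $n$ for which there exists a convex lattice $n$-gon $P$ with $B(P)=n$ and $I(P)=k$ whose $k$ interior lattice points are collinear are exactly $n=3,4,5,6$.
   Context: A lattice point is an element of $\mathbb{Z}^2$. A lattice polygon is a simple polygon in $\mathbb{R}^2$ whose vertices are lattice points; an $n$-gon is a polygon with exactly $n$ vertices ($n\ge 3$). A lattice polygon is convex if all its interior angles (at its vertices) are strictly less than $\pi$. $B(P)$ is the number of lattice points on the boundary of $P$ and $I(P)$ is the number of lattice points in the interior of $P$. Thus $B(P)=n$ for an $n$-gon means that the only boundary lattice points are the vertices. *)

(* Defs.v *)
From HB Require Import structures.
From mathcomp Require Import all_boot all_order all_algebra.
From mathcomp Require Import all_classical all_reals all_analysis.

Set Implicit Arguments.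
Unset Strict Implicit.
Unset Printing Implicit Defensive.

Import Order.TTheory GRing.Theory Num.Theory.
Import numFieldNormedType.Exports.
Local Open Scope classical_set_scope.
Local Open Scope ring_scope.

Notation plane R := (R * R)%type.

Definition lattice (R : realType) : set (plane R) :=
  [set p | p.1 \is a Num.int /\ p.2 \is a Num.int].

Definition segment (R : realType) (x y : plane R) : set (plane R) :=
  [set (1 - t) *: x + t *: y | t in `[0, 1]].

Definition dot (R : realType) (u v : plane R) : R := u.1 * v.1 + u.2 * v.2.

Definition angle (R : realType) (u v : plane R) : R :=
  acos (dot u v / (Num.sqrt (dot u u) * Num.sqrt (dot v v))).

Definition collinear (R : realType) (A : set (plane R)) : Prop :=
  exists a b c : R, (a, b) <> (0, 0) /\
    forall p, A p -> a * p.1 + b * p.2 = c.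

(* A polygon is given by the cyclic sequence [P] of its vertices, the successor
   of the vertex [P i] being [P (ordS i)]. *)
Section Polygon.
Context {R : realType} {n : nat}.
Implicit Type P : 'I_n -> plane R.

Definition edge P (i : 'I_n) : set (plane R) := segment (P i) (P (ordS i)).

(* For 3 <= n at most one of the two alternatives holds for given [i] and [j]. *)
Definition simple_polygon P : Prop :=
  [/\ (3 <= n)%N, injective P &
      forall i j, i != j -> forall x, edge P i x -> edge P j x ->
        (j = ordS i /\ x = P j) \/ (i = ordS j /\ x = P i)].

Definition boundary P : set (plane R) := \bigcup_i edge P i.

(* The points in the bounded part of the complement of the boundary curve.
   The first condition is needed because [connected_component A x] is empty,
   hence bounded, when [x] is not in [A]. *)
Definition inside P : set (plane R) :=
  [set x | ~ boundary P x /\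
           bounded_set (connected_component (~` boundary P) x)].

(* With [a] and [b] the directions of the two edges at the vertex [P i], the
   vector [a + b] points into the convex one of the two sectors they bound.
   The interior angle is the angle of that sector if the sector is on the inner
   side of the polygon, and otherwise the angle of the complementary sector.
   (If the two edges are opposite then both angles are pi.) *)
Definition interior_angle P (i : 'I_n) : R :=
  let a := P (ordS i) - P i in
  let b := P (ord_pred i) - P i in
  if `[< \forall t \near (0 : R)^'+, inside P (P i + t *: (a + b)) >]
  then angle a b else pi *+ 2 - angle a b.

Definition lattice_polygon P : Prop :=
  simple_polygon P /\ forall i, lattice (P i).

Definition convex_polygon P : Prop := forall i, interior_angle P i < pi.

Definition boundary_lattice_points P : set (plane R) :=
  boundary P `&` @lattice R.

Definition interior_lattice_points P : set (plane R) :=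
  inside P `&` @lattice R.

End Polygon.

(* Main.v *)
Require Import Defs.
From HB Require Import structures.
From mathcomp Require Import all_boot all_order all_algebra.
From mathcomp Require Import all_classical all_reals all_analysis.
From mathcomp Require Import ring lra zify.
Set Implicit Arguments.
Unset Strict Implicit.
Unset Printing Implicit Defensive.
Import Order.TTheory GRing.Theory Num.Theory.
Import numFieldNormedType.Exports.
Local Open Scope classical_set_scope.
Local Open Scope ring_scope.
Local Open Scope card_scope.

(** The heart of the proof is that the convex polygons of the statement, which
are defined through the inner angles of a simple closed curve, are exactly the
polygons in strictly convex position: for one orientation [c], each vertex
lies strictly on the positive side of every edge that it does not belong to.

Strictly convex position is easy to work with. The sides of the edges cut out
a bounded convex region: its points with all [side] values positive form the
inside, the others the boundary ([inside_strictly_convexP],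
[boundary_strictly_convexP]), and such a polygon is simple with convex angles.

The converse ([convex_polygon_strictly_convex]) is a passage from local to
global convexity. At a vertex, an inner angle below pi says that the convex
sector between the two edges is inside. At a leftmost vertex the reflex sector
is outside, because a horizontal ray leads away from it. Being outside is then
inherited along the curve: the outer side of an edge continues, at the next
vertex, into one of the two sectors there, and this cannot be the convex one.
So all turns have the same direction, every reflex sector is outside, and the
filled polygon [filled P] (inside and boundary together) is locally convex. It
is also compact and connected, hence convex by the theorem of Tietze and
Nakajima ([locally_convex_convex]), which is proved here by taking a chain of
short steps of least energy between two points. Near the middle of an edge the
filled polygon is a half ball, so by convexity it lies on one side of the edge.

For the bound n <= 6, take two inner lattice points of different parity class
modulo 2; they exist, since two inner lattice points of the same class have an
inner lattice point halfway. Let L be the line through the inner lattice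
points. A vertex off L has neither of these two classes, as the midpoint with
an inner lattice point would be an inner lattice point off L. Two vertices on
the same side of L do not share a class either: their midpoint would be a
lattice point off L, and it can neither be inside nor be one of the vertices,
which are the only lattice points of the boundary. So there are at most two
vertices on each side of L, and at most two on L ([card_vertices_le6]).

The examples have the inner points (1,0), ..., (k,0) and their vertices at
height -1, 0 and 1 ([example_of_each_size]). *)

(** * Orientation of three points *)

Definition cross (R : realType) (u v : plane R) : R := u.1 * v.2 - u.2 * v.1.

(** Twice the signed area of the triangle [p q r]. *)
Definition orient (R : realType) (p q r : plane R) : R := cross (q - p) (r - p).

Section Orientation.
Context {R : realType}.
Implicit Types (a b p q r x y u v w : plane R) (t c : R).

Lemma orientpqp p q : orient p q p = 0.
Proof. by rewrite /orient /cross subrr /=; ring. Qed.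

Lemma orientpqq p q : orient p q q = 0.
Proof. by rewrite /orient /cross /=; ring. Qed.

Lemma orient_conv p q x y t :
  orient p q ((1 - t) *: x + t *: y) = (1 - t) * orient p q x + t * orient p q y.
Proof. by rewrite /orient /cross /= /GRing.scale /=; ring. Qed.

Lemma orientD p q x v t :
  orient p q (x + t *: v) = orient p q x + t * cross (q - p) v.
Proof. by rewrite /orient /cross /= /GRing.scale /=; ring. Qed.

Lemma continuous_orient p q : continuous (orient p q).
Proof.
move=> x; rewrite /orient /cross.
by apply: cvgB; apply: cvgMl_tmp; (apply: cvgB; last exact: cvg_cst);
  [exact: cvg_snd|exact: cvg_fst].
Qed.

(** Along the line [p q], the distance to another line through [p] grows
proportionally. *)
Lemma line_param a p q x : orient p q x = 0 -> orient a p q != 0 ->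
  x = (1 - orient a p x / orient a p q) *: p + (orient a p x / orient a p q) *: q.
Proof.
move=> pqx apq.
have E (f := orient a p q) : f *: x = (f - orient a p x) *: p + orient a p x *: q.
  have -> : f *: x = f *: x + orient p q x *: (p - a).
    by rewrite pqx scale0r addr0.
  apply/pair_equal_spec; rewrite /f /orient /cross /= /GRing.scale /=.
  by split; ring.
rewrite -[LHS](scalerK apq) E scalerDr !scalerA mulrBr mulVf //.
by rewrite ![_^-1 * _]mulrC.
Qed.

Lemma cross_solve u v w : cross u v *: w = cross u w *: v - cross v w *: u.
Proof.
apply/pair_equal_spec; rewrite /cross /=.
by rewrite /GRing.scale /=; split; ring.
Qed.

End Orientation.

(** * Segments, convex sets and components *)

Lemma bounded_setP (R : realType) (V : normedModType R) (A : set V) :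
  bounded_set A <-> exists M, forall x, A x -> `|x| <= M.
Proof.
split=> [/ex_strict_bound_gt0 [M _ AM]|[M AM]]; first by exists M => x /AM/ltW.
exists M; split=> [|N MN x Ax]; first exact: num_real.
exact: le_trans (AM x Ax) (ltW MN).
Qed.

Section PlaneTopology.
Context {R : realType}.
Implicit Types (x y v : plane R) (A C : set (plane R)) (t : R).

Definition seg_convex A := forall x y, A x -> A y -> segment x y `<=` A.

Lemma continuous_line x v : continuous (fun t => x + t *: v).
Proof.
by move=> t; apply: cvgD; [exact: cvg_cst|apply: cvgZr_tmp; exact: cvg_id].
Qed.

Lemma segmentE x y : segment x y = (fun t => x + t *: (y - x)) @` `[0, 1].
Proof.
apply: eq_imagel => t _ /=.
by rewrite scalerBr scalerBl scale1r addrAC addrA.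
Qed.

Lemma connected_segment x y : connected (segment x y).
Proof.
rewrite segmentE; apply: connected_continuous_connected.
  exact: segment_connected.
by apply: continuous_subspaceT; exact: continuous_line.
Qed.

Lemma compact_segment x y : compact (segment x y).
Proof.
rewrite segmentE; apply: continuous_compact; last exact: segment_compact.
by apply: continuous_subspaceT; exact: continuous_line.
Qed.

Lemma segment_left x y : segment x y x.
Proof.
by exists 0; rewrite /= ?in_itv/= ?lexx ?ler01// subr0 scale1r scale0r addr0.
Qed.

Lemma segment_right x y : segment x y y.
Proof.
by exists 1; rewrite /= ?in_itv/= ?lexx ?ler01// subrr scale1r scale0r add0r.
Qed.

Lemma connected_seg_convex A : seg_convex A -> connected A.
Proof.
move=> cA; have [[x Ax]|/set0P/negP/negbNE/eqP->] := pselect (A !=set0); last first.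
  exact: connected0.
have -> : A = \bigcup_(y in A) segment x y.
  apply/seteqP; split=> y; first by move=> Ay; exists y => //; exact: segment_right.
  by move=> [z Az]; exact: cA.
apply: bigcup_connected => [|y _]; last exact: connected_segment.
by exists x => y _; exact: segment_left.
Qed.

Lemma seg_convex_ball x (e : R) : seg_convex (ball x e).
Proof.
move=> y z; rewrite -!ball_normE /= => xy xz _ [t /= /itvP t01 <-].
have -> : x - ((1 - t) *: y + t *: z) = (1 - t) *: (x - y) + t *: (x - z).
  by rewrite !scalerBr opprD addrACA -scalerDl subrK scale1r.
apply: le_lt_trans (ler_normD _ _) _; rewrite !normrZ.
rewrite !ger0_norm ?subr_ge0 ?t01 //.
have -> : e = (1 - t) * e + t * e by rewrite -mulrDl subrK mul1r.
have [->|t_neq0] := eqVneq t 0; first by rewrite subr0 !mul1r !mul0r !addr0.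
rewrite ler_ltD // ?ler_wpM2l ?subr_ge0 ?t01 ?ltW //.
by rewrite ltr_pM2l // lt_def t_neq0 t01.
Qed.

Lemma seg_convexI A C : seg_convex A -> seg_convex C -> seg_convex (A `&` C).
Proof.
by move=> cA cC x y [Ax Cx] [Ay Cy] z xyz; split; [exact: cA xyz|exact: cC xyz].
Qed.

Lemma seg_convex_gt p q (c : R) : seg_convex [set x | 0 < c * orient p q x].
Proof.
move=> x y /= x0 y0 _ [t /= /itvP t01 <-]; rewrite orient_conv.
have t0 : 0 <= t by rewrite t01.
have t1 : t <= 1 by rewrite t01.
have [->|t_neq0] := eqVneq t 0; first by rewrite subr0 mul1r mul0r addr0.
have : 0 < t by rewrite lt_def t_neq0.
nra.
Qed.

Lemma seg_convex_ge p q (c : R) : seg_convex [set x | 0 <= c * orient p q x].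
Proof.
move=> x y /= x0 y0 _ [t /= /itvP t01 <-]; rewrite orient_conv.
have t0 : 0 <= t by rewrite t01.
have t1 : t <= 1 by rewrite t01.
nra.
Qed.

End PlaneTopology.

Section Inside.
Context {R : realType} {n : nat}.
Variable P : 'I_n -> plane R.
Implicit Types (x y v : plane R) (C : set (plane R)).

(** The complement of the curve falls into components, each of which lies
either inside or outside. *)
Lemma inside_connected C x y : connected C -> C `<=` ~` boundary P ->
  C x -> C y -> inside P x -> inside P y.
Proof.
move=> cC CP Cx Cy [_ bx]; split; first exact: CP.
rewrite -(same_connected_component (connected_component_max Cx CP cC Cy)).
exact: bx.
Qed.

(** A point that can leave every bounded set without crossing the curve lies in
an unbounded component. *)
Lemma line_not_inside (A : set R) x v : connected A -> A 0 -> ~ bounded_set A ->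
  v != 0 -> (forall t, A t -> ~ boundary P (x + t *: v)) -> ~ inside P x.
Proof.
move=> cA A0 ubA v0 H [_ /bounded_setP [M HM]]; apply/ubA/bounded_setP.
have sub : (fun t : R => x + t *: v) @` A `<=` connected_component (~` boundary P) x.
  apply: connected_component_max.
  - by exists 0 => //; rewrite scale0r addr0.
  - by move=> _ [t At <-]; exact: H.
  - apply: connected_continuous_connected => //.
    by apply: continuous_subspaceT; exact: continuous_line.
have nv : 0 < `|v| by rewrite normr_gt0.
exists ((M + `|x|) / `|v|) => t At.
have {}HM := HM _ (sub _ (imageP (fun t => x + t *: v) At)).
rewrite ler_pdivlMr // -normrZ.
have -> : t *: v = (x + t *: v) - x by rewrite addrC addKr.
by rewrite (le_trans (ler_normB _ _))// lerD2r.
Qed.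

Lemma ray_not_inside x v : v != 0 ->
  (forall t, 0 <= t -> ~ boundary P (x + t *: v)) -> ~ inside P x.
Proof.
move=> v0 H; apply: (@line_not_inside `[0, +oo[ x v) => //.
- by apply/connected_intervalP; exact: interval_is_interval.
- by rewrite /= in_itv/= lexx.
- move=> /bounded_setP [M HM].
  have /HM : `[0, +oo[%classic (`|M| + 1) by rewrite /= in_itv/= andbT addr_ge0.
  rewrite ger0_norm ?addr_ge0 // => /le_trans /(_ (ler_norm _)).
  by rewrite gerDl ler10.
- by move=> t /=; rewrite in_itv/= andbT; exact: H.
Qed.

End Inside.

(** * Polygons in strictly convex position *)

Section CyclicOrdinals.
Context {n : nat}.
Hypothesis n_ge3 : (3 <= n)%N.
Implicit Types i j : 'I_n.

Lemma ordS_neq i : ordS i != i.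
Proof.
apply/eqP => /(congr1 val) /=; have := ltn_ord i.
rewrite leq_eqVlt => /predU1P[eqn|lt_in].
  by rewrite eqn modnn => i0; move: n_ge3; rewrite -eqn -i0.
by rewrite modn_small // => /eqP; rewrite eqn_leq ltnn.
Qed.

Lemma ordSS_neq i : ordS (ordS i) != i.
Proof.
apply/eqP => /(congr1 val) /=; have := ltn_ord i.
rewrite leq_eqVlt => /predU1P[eqn|lt_in].
  rewrite eqn modnn modn_small; last exact: ltn_trans n_ge3.
  by move=> i1; move: n_ge3; rewrite -eqn -i1.
rewrite (modn_small lt_in); move: lt_in; rewrite leq_eqVlt => /predU1P[eqn|lt_in].
  by rewrite eqn modnn => i0; move: n_ge3; rewrite -eqn -i0.
by rewrite modn_small // => /eqP; rewrite -addn2 -{2}[val i]addn0 eqn_add2l.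
Qed.

Lemma ord_pred_neq i : ord_pred i != i.
Proof. by rewrite -{2}[i]ord_predK eq_sym ordS_neq. Qed.

Lemma ordS_neq_pred i : ordS i != ord_pred i.
Proof. by rewrite -{1}[i]ord_predK ordSS_neq. Qed.

End CyclicOrdinals.

Lemma near_gt0 (R : realType) (T : topologicalType) (f : T -> R) x :
  {for x, continuous f} -> 0 < f x -> \forall y \near x, 0 < f y.
Proof. by move=> cf fx; exact: cvgr_gt cf _ fx. Qed.

Section Side.
Context {R : realType} {n : nat}.
Variables (c : R) (P : 'I_n -> plane R).
Implicit Types (i j : 'I_n) (x y : plane R).

(** The sign of [c] is the orientation of the polygon, and positive values of
[side i] are meant to lie on the inner side of the edge [i]. *)
Definition side i x : R := c * orient (P i) (P (ordS i)) x.

Definition strictly_convex : Prop :=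
  forall i j, j != i -> j != ordS i -> 0 < side i (P j).

Lemma side_left i : side i (P i) = 0.
Proof. by rewrite /side orientpqp mulr0. Qed.

Lemma side_right i : side i (P (ordS i)) = 0.
Proof. by rewrite /side orientpqq mulr0. Qed.

Lemma side_conv i x y t :
  side i ((1 - t) *: x + t *: y) = (1 - t) * side i x + t * side i y.
Proof. by rewrite /side orient_conv; ring. Qed.

Lemma sideD i x v t :
  side i (x + t *: v) = side i x + t * (c * cross (P (ordS i) - P i) v).
Proof. by rewrite /side orientD; ring. Qed.

Lemma continuous_side i : continuous (side i).
Proof. by move=> x; apply: cvgMl_tmp; exact: continuous_orient. Qed.

Lemma edge_side i x : edge P i x -> side i x = 0.
Proof. by move=> [t _ <-]; rewrite side_conv side_left side_right !mulr0 addr0. Qed.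

(** On the line through an edge, the two neighbouring edges cut off exactly
the edge. *)
Lemma edge_between i x :
  0 < side (ord_pred i) (P (ordS i)) -> 0 < side (ordS i) (P i) ->
  0 <= side (ord_pred i) x -> 0 <= side (ordS i) x -> side i x = 0 -> edge P i x.
Proof.
move=> d0 e0 xp xn six.
have c0 : c != 0 by apply: contraTneq e0 => c0; rewrite /side c0 mul0r ltxx.
have xE : x = (1 - side (ord_pred i) x / side (ord_pred i) (P (ordS i))) *: P i
  + (side (ord_pred i) x / side (ord_pred i) (P (ordS i))) *: P (ordS i).
  rewrite /side ord_predK -mulf_div divff // mul1r; apply: line_param.
    by move/eqP: six; rewrite mulf_eq0 (negPf c0) => /eqP.
  by apply: contraTneq d0; rewrite /side ord_predK => ->; rewrite mulr0 ltxx.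
set s := (_ / _) in xE; exists s => //=; rewrite in_itv/=.
apply/andP; split; first by rewrite divr_ge0 // ltW.
move: xn; rewrite {1}xE side_conv side_left mulr0 addr0.
by rewrite pmulr_lge0 // subr_ge0.
Qed.

(** The gradients of the [side i] are the edge vectors turned by a right angle,
and these add up to zero around the curve. *)
Lemma sum_side x : \sum_i side i x = \sum_i side i 0.
Proof.
apply: subr0_eq; rewrite -sumrB.
pose f i := c * (x.2 * (P i).1 - x.1 * (P i).2).
rewrite (eq_bigr (fun i => f (ordS i) - f i)) => [|i _]; last first.
  by rewrite /side /f /orient /cross /=; ring.
by rewrite sumrB -(reindex_inj (F := f) (P := predT) (@ordS_inj n)) subrr.
Qed.

End Side.

Lemma segment_ge0 (R : realType) (f : plane R -> R) x y z :
  (forall t, f ((1 - t) *: x + t *: y) = (1 - t) * f x + t * f y) ->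
  0 <= f x -> 0 <= f y -> segment x y z -> 0 <= f z.
Proof.
move=> fE fx fy [t /= /itvP t01 <-]; rewrite fE.
by rewrite addr_ge0 // mulr_ge0 // ?subr_ge0 t01.
Qed.

Section StrictlyConvex.
Context {R : realType} {n : nat}.
Variables (c : R) (P : 'I_n -> plane R).
Hypothesis n_ge3 : (3 <= n)%N.
Hypothesis scP : strictly_convex c P.
Implicit Types (i j : 'I_n) (x y : plane R).

Lemma side_pred_gt0 i : 0 < side c P (ord_pred i) (P (ordS i)).
Proof. by apply: scP; rewrite ?ord_predK ?ordS_neq ?ordS_neq_pred. Qed.

Lemma side_next_gt0 i : 0 < side c P (ordS i) (P i).
Proof. by apply: scP; rewrite eq_sym ?ordS_neq ?ordSS_neq. Qed.

Lemma side_ge0 i j : 0 <= side c P i (P j).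
Proof.
have [->|ji] := eqVneq j i; first by rewrite side_left.
have [->|jSi] := eqVneq j (ordS i); first by rewrite side_right.
by rewrite ltW // scP.
Qed.

Lemma edge_side_ge0 i j x : edge P i x -> 0 <= side c P j x.
Proof.
by apply: segment_ge0; [move=> t; rewrite side_conv|exact: side_ge0..].
Qed.

Lemma edge_of_side0 i x :
  (forall j, 0 <= side c P j x) -> side c P i x = 0 -> edge P i x.
Proof.
by move=> x_ge0; apply: edge_between; rewrite ?side_pred_gt0 ?side_next_gt0.
Qed.

Lemma boundary_strictly_convexP x : boundary P x <->
  (forall j, 0 <= side c P j x) /\ exists i, side c P i x = 0.
Proof.
split=> [[i _ Pix]|[x_ge0 [i six]]].
  by split=> [j|]; [exact: edge_side_ge0 Pix|exists i; exact: edge_side].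
by exists i => //; exact: edge_of_side0.
Qed.

(** As the [side j] have a constant sum, they are bounded where they are all
nonnegative, and the values of two of them determine the point. *)
Lemma bounded_strictly_convex : bounded_set [set x | forall j, 0 <= side c P j x].
Proof.
apply/bounded_setP; pose S := \sum_i side c P i 0.
pose i : 'I_n := Ordinal (ltn_trans (isT : (0 < 2)%N) n_ge3).
have side_le x : (forall j, 0 <= side c P j x) -> forall j, side c P j x <= S.
  move=> x_ge0 j; rewrite /S -(sum_side c P x) (bigD1 j) //= lerDl.
  by apply: sumr_ge0.
pose a := P i - P (ord_pred i); pose u := P (ordS i) - P i.
have aE x : c * cross a (x - P i) = side c P (ord_pred i) x.
  by rewrite /side ord_predK /orient /cross /a /=; ring.
have uE x : c * cross u (x - P i) = side c P i x by [].
have d0 : 0 < c * cross a u by rewrite aE side_pred_gt0.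
exists (`|P i| + (S * `|u| + S * `|a|) / (c * cross a u)) => x x_ge0.
rewrite -[x](subrK (P i)) addrC (le_trans (ler_normD _ _)) // lerD2l.
rewrite ler_pdivlMr // mulrC -[X in X * _]gtr0_norm // -normrZ -scalerA.
rewrite cross_solve scalerBr !scalerA aE uE (le_trans (ler_normB _ _)) //.
by apply: lerD; rewrite normrZ (ger0_norm (x_ge0 _)) ler_wpM2r // side_le.
Qed.

(** A point with [side k] negative escapes to infinity parallel to the edge [k],
within the half plane beyond it. A component that meets the region where all
[side j] are positive is contained in it, for this region is both open and
closed in the complement of the curve. *)
Lemma inside_strictly_convexP x :
  inside P x <-> forall j, 0 < side c P j x.
Proof.
pose i0 : 'I_n := Ordinal (ltn_trans (isT : (0 < 2)%N) n_ge3).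
split=> [Px j|x_gt0].
  rewrite ltNge; apply/negP => jx; have [nbx _] := Px.
  suff [k kx] : exists k, side c P k x < 0.
    pose v := P (ordS k) - P k.
    have xv t : side c P k (x + t *: v) = side c P k x.
      by rewrite sideD /cross /v /=; ring.
    have v0 : v != 0.
      apply: contraTneq (side_pred_gt0 k) => /eqP; rewrite subr_eq0 => /eqP->.
      by rewrite -{2}[k]ord_predK side_right ltxx.
    move: Px; apply: (ray_not_inside v0) => t t0.
    by move=> /boundary_strictly_convexP [/(_ k)]; rewrite xv leNgt kx.
  apply: contrapT => /forallNP H; apply/nbx/boundary_strictly_convexP.
  have x_ge0 k : 0 <= side c P k x by rewrite leNgt; apply/negP.
  by split=> //; exists j; apply/eqP; rewrite eq_le jx x_ge0.
have sub : connected_component (~` boundary P) x `<=`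
    [set x | forall j, 0 <= side c P j x].
  pose C := connected_component (~` boundary P) x.
  have CP : C `<=` ~` boundary P by exact: connected_component_sub.
  suff CE : C `&` [set y | forall j, 0 < side c P j y] = C.
    by move=> y; rewrite -/C -CE => -[_ y_gt0] j; exact: ltW.
  apply: (@component_connected _ (~` boundary P) x).
  - exists x; split=> //; apply: connected_component_refl.
    move=> /boundary_strictly_convexP [_ [i xi]].
    by have := x_gt0 i; rewrite xi ltxx.
  - exists [set y | forall j, 0 < side c P j y] => //.
    rewrite openE => y /= y_gt0.
    apply: (@filter_forall _ _ (fun j z => 0 < side c P j z) (nbhs y)) => j.
    exact: (near_gt0 (@continuous_side _ _ c P j y)).
  - exists [set y | forall j, 0 <= side c P j y].
      rewrite (_ : mkset _ = \bigcap_j [set y | 0 <= side c P j y]); last first.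
        by apply/seteqP; split=> y H j => [_|]; exact: H.
      apply: closed_bigI => j _.
      apply: (@preimage_closed _ _ (side c P j) [set z | 0 <= z]).
        by move=> y _; exact: continuous_side.
      exact: closed_ge.
    apply/seteqP; split=> y [Cy y_ge0]; split=> // j; first exact: ltW.
    rewrite lt_def y_ge0 andbT; apply/eqP => yj; apply: (CP _ Cy).
    by apply/boundary_strictly_convexP; split=> //; exists j.
split.
  move=> /boundary_strictly_convexP [_ [i xi]].
  by have := x_gt0 i; rewrite xi ltxx.
have [M HM] := (bounded_setP _).1 bounded_strictly_convex.
by apply/bounded_setP; exists M => y /sub; exact: HM.
Qed.

Lemma strictly_convex_inj : injective P.
Proof.
move=> i j Pij; apply/eqP/contraT => ij.
have [jS|jS] := eqVneq j (ordS i).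
  have := side_pred_gt0 i.
  by rewrite -jS -Pij -{2}[i]ord_predK side_right ltxx.
have := scP (i := i) (j := j); rewrite eq_sym -Pij side_left ltxx => H.
by have := H ij jS.
Qed.

(** Each [side j] is nonnegative on the vertices, so it vanishes in the middle of
an edge only if it vanishes at both ends. *)
Lemma strictly_convex_simple : simple_polygon P.
Proof.
split=> //; first exact: strictly_convex_inj.
move=> i j ij x xi xj.
have Pinj := strictly_convex_inj.
have vertex k : side c P j (P k) = 0 -> k = j \/ k = ordS j.
  move=> jk; have [->|kj] := eqVneq k j; first by left.
  have [->|kSj] := eqVneq k (ordS j); first by right.
  by have := scP kj kSj; rewrite jk ltxx.
have := edge_side c xj; case: (xi) => t /= /itvP t01 <-; rewrite side_conv.
have [->|t0] := eqVneq t 0.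
  rewrite subr0 mul1r mul0r addr0 scale1r scale0r addr0.
  by move=> /vertex [/eqP|]; [rewrite (negPf ij)|right].
have [->|t1] := eqVneq t 1.
  rewrite subrr mul1r mul0r add0r scale1r scale0r add0r.
  move=> /vertex [<-|/ordS_inj /eqP]; last by rewrite (negPf ij).
  by left.
have t_gt0 : 0 < t by rewrite lt_def t0 t01.
have t_lt1 : 0 < 1 - t by rewrite subr_gt0 lt_neqAle t1 t01.
move=> /eqP.
rewrite paddr_eq0; [|by apply: mulr_ge0; [exact: ltW|exact: side_ge0]..].
rewrite (mulf_eq0 (1 - t)) (mulf_eq0 t) (gt_eqF t_lt1) (gt_eqF t_gt0) /=.
move=> /andP[/eqP/vertex iV /eqP/vertex SiV].
case: iV => [/eqP|iE]; first by rewrite (negPf ij).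
case: SiV => [Si|/ordS_inj /eqP]; last by rewrite (negPf ij).
by have := ordSS_neq n_ge3 i; rewrite Si -iE eqxx.
Qed.

End StrictlyConvex.

(** * Angles *)

Section Angles.
Context {R : realType}.
Implicit Types u v : plane R.

Lemma dot_ge0 u : 0 <= dot u u.
Proof. by rewrite /dot addr_ge0 // -expr2 sqr_ge0. Qed.

Lemma dot_eq0 u : dot u u = 0 -> u = 0.
Proof.
move=> /eqP; rewrite /dot paddr_eq0 -?expr2 ?sqr_ge0 // !sqrf_eq0.
by move=> /andP[/eqP u1 /eqP u2]; rewrite [u]surjective_pairing u1 u2.
Qed.

Lemma dot_gt0 u : u != 0 -> 0 < dot u u.
Proof.
by move=> u0; rewrite lt_def dot_ge0 andbT; apply: contraNneq u0 => /dot_eq0 ->.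
Qed.

Lemma parallel_scale u v : u != 0 -> cross u v = 0 ->
  v = (dot u v / dot u u) *: u.
Proof.
move=> /dot_gt0 du uv; rewrite [_ / _]mulrC -scalerA.
have <- : dot u u *: v = dot u v *: u.
  rewrite -[LHS]subr0 -(scale0r (- u.2, u.1)) -uv.
  by apply/pair_equal_spec; rewrite /dot /cross /= /GRing.scale /=; split; ring.
by rewrite scalerA mulVf ?scale1r // gt_eqF.
Qed.

Lemma sqr_dot_cross u v : dot u v ^+ 2 + cross u v ^+ 2 = dot u u * dot v v.
Proof. by rewrite /dot /cross; ring. Qed.

Let cosine u v := dot u v / (Num.sqrt (dot u u) * Num.sqrt (dot v v)).

Let sqr_cosine u v : cosine u v ^+ 2 = dot u v ^+ 2 / (dot u u * dot v v).
Proof. by rewrite /cosine exprMn exprVn exprMn !sqr_sqrtr ?dot_ge0. Qed.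

Let cosine_bound u v : -1 <= cosine u v <= 1.
Proof.
rewrite -ler_norml -sqrtr_sqr sqr_cosine -[leRHS]sqrtr1 ler_wsqrtr //.
have := mulr_ge0 (dot_ge0 u) (dot_ge0 v); rewrite le0r => /predU1P[->|uv0].
  by rewrite invr0 mulr0 ler01.
by rewrite ler_pdivrMr // mul1r -sqr_dot_cross lerDl sqr_ge0.
Qed.

Lemma angle_le_pi u v : angle u v <= pi.
Proof. exact/acos_lepi/cosine_bound. Qed.

Lemma angle_lt_pi u v : cross u v != 0 -> angle u v < pi.
Proof.
move=> uv; apply: acos_ltpi; rewrite -/(cosine u v).
have /andP[l ->] := cosine_bound u v; rewrite andbT lt_def l andbT.
apply: contraNneq uv => /esym cos1.
have := sqr_cosine u v; rewrite -cos1 sqrrN expr1n => E.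
have d0 : dot u u * dot v v != 0.
  by apply: contra_eq_neq E => ->; rewrite invr0 mulr0 oner_neq0.
rewrite -sqrf_eq0 -(addKr (dot u v ^+ 2) (cross u v ^+ 2)) sqr_dot_cross.
by rewrite -[X in _ + X]mul1r E divfK // addNr.
Qed.

(** Opposite vectors form the angle pi. *)
Lemma angle_parallel u v : u != 0 -> v != 0 -> cross u v = 0 ->
  angle u v < pi -> 0 < dot u v.
Proof.
move=> u0 v0 uv; have := sqr_dot_cross u v; rewrite uv expr0n /= addr0 => duv.
have du := dot_gt0 u0; have dv := dot_gt0 v0.
apply: contraTT; rewrite -!leNgt => duv_le0.
suff -> : angle u v = pi by [].
rewrite /angle -sqrtrM ?dot_ge0 // -duv sqrtr_sqr ler0_norm // invrN mulrN.
rewrite divff ?acosN1 //.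
by rewrite -sqrf_eq0 duv mulf_neq0 ?gt_eqF.
Qed.

End Angles.

Section AnglesOfPolygon.
Context {R : realType} {n : nat}.
Variable P : 'I_n -> plane R.
Hypothesis n_ge3 : (3 <= n)%N.
Implicit Types (i j : 'I_n) (x y : plane R).

(** The bisector of the two edges points into the region where all sides are
positive, so the inner angle is the one below pi. *)
Lemma strictly_convex_polygon c : strictly_convex c P -> convex_polygon P.
Proof.
move=> scP i; rewrite /interior_angle.
set a := P (ordS i) - P i; set b := P (ord_pred i) - P i.
have d0 := side_pred_gt0 n_ge3 scP i.
have dE : side c P (ord_pred i) (P (ordS i)) = c * cross a b.
  by rewrite /side ord_predK /orient /cross /a /b /=; ring.
rewrite dE in d0.
case: asboolP => [_|].
  by apply: angle_lt_pi; apply: contraTneq d0 => ->; rewrite mulr0 ltxx.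
case; suff : \forall t \near (0 : R)^'+, forall j, 0 < side c P j (P i + t *: (a + b)).
  by apply: filterS => t; exact: (inside_strictly_convexP n_ge3 scP _).2.
apply: filter_forall => j.
have [->|ji] := eqVneq j i.
  near=> t; have t0 : 0 < t by near: t; exact: nbhs_right_gt.
  rewrite sideD side_left add0r mulr_gt0 //.
  by have -> : c * cross (P (ordS i) - P i) (a + b) = c * cross a b
    by rewrite /cross /a /b /=; ring.
have [->|jp] := eqVneq j (ord_pred i).
  near=> t; have t0 : 0 < t by near: t; exact: nbhs_right_gt.
  rewrite sideD -{2}[i]ord_predK side_right add0r mulr_gt0 //.
  by have -> : c * cross (P (ordS (ord_pred i)) - P (ord_pred i)) (a + b) = c * cross a b
    by rewrite ord_predK /cross /a /b /=; ring.
have j0 : 0 < side c P j (P i).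
  by apply: scP; rewrite eq_sym // -[i]ord_predK (inj_eq (@ordS_inj n)).
have : side c P j (P i + t *: (a + b)) @[t --> 0^'+] --> side c P j (P i).
  apply: cvg_at_right_filter.
  have -> : side c P j (P i) = side c P j (P i + 0 *: (a + b)).
    by rewrite scale0r addr0.
  by apply: (continuous_comp (@continuous_line _ _ _ _)); exact: continuous_side.
by move=> /cvgr_gt; apply.
Unshelve. all: end_near. Qed.

(** The angle at a vertex cannot degenerate: if its two edges were
opposite it would be flat, and if they had the same direction they would
overlap. *)
Lemma convex_vertex : simple_polygon P -> convex_polygon P -> forall i,
  orient (P (ord_pred i)) (P i) (P (ordS i)) != 0 /\
  \forall t \near (0 : R)^'+,
    inside P (P i + t *: ((P (ordS i) - P i) + (P (ord_pred i) - P i))).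
Proof.
move=> [_ Pinj sP] cP i; have := cP i; rewrite /interior_angle.
set a := P (ordS i) - P i; set b := P (ord_pred i) - P i.
case: asboolP => [nin ab|_]; last first.
  by rewrite ltrBlDl mulr2n ltrD2r ltNge angle_le_pi.
split=> //.
have -> : orient (P (ord_pred i)) (P i) (P (ordS i)) = cross a b.
  by rewrite /orient /cross /a /b /=; ring.
apply/eqP => ab0.
have a0 : a != 0 by rewrite subr_eq0 (inj_eq Pinj) ordS_neq.
have b0 : b != 0 by rewrite subr_eq0 (inj_eq Pinj) ord_pred_neq.
have dab := angle_parallel a0 b0 ab0 ab.
have du := dot_gt0 a0.
have bE := parallel_scale a0 ab0.
set s := _ / _ in bE; have s0 : 0 < s by rewrite divr_gt0.
have pi : ord_pred i != i by rewrite ord_pred_neq.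
have edgeE j : edge P j = (fun t => P j + t *: (P (ordS j) - P j)) @` `[0, 1].
  by rewrite /edge segmentE.
(* The shorter of the two edges is contained in the other one. *)
have [s1|s1] := leP s 1.
  have : edge P i (P (ord_pred i)).
    rewrite edgeE; exists s; first by rewrite /= in_itv/= ltW.
    by rewrite -/a -bE addrC subrK.
  move=> /(sP i (ord_pred i)); rewrite eq_sym => /(_ pi (segment_left _ _)).
  case=> [[/eqP]|[_ /Pinj /eqP]]; last by rewrite (negPf pi).
  by rewrite eq_sym (negPf (ordS_neq_pred n_ge3 i)).
have : edge P (ord_pred i) (P (ordS i)).
  rewrite /edge ord_predK; exists (1 - s^-1).
    rewrite /= in_itv/= subr_ge0 invf_le1 // ltW //= gerBl invr_ge0 ltW //.
  have -> : P (ord_pred i) = P i + s *: a by rewrite -bE addrC subrK.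
  rewrite subKr scalerDr scalerA mulVf ?gt_eqF // scale1r addrAC -scalerDl.
  by rewrite [s^-1 + _]addrC subrK scale1r addrC subrK.
move=> /(sP (ord_pred i) i pi _) /(_ (segment_right _ _)).
case=> [[_ /Pinj/eqP]|[/esym/eqP]]; first by rewrite (negPf (ordS_neq n_ge3 i)).
by rewrite (negPf (ordS_neq_pred n_ge3 i)).
Qed.

End AnglesOfPolygon.

(** * Locally convex sets *)

Section LocalConvexity.
Context {R : realType}.
Implicit Types (K : set (plane R)) (x y z : plane R) (e : R) (N : nat).

(** Compactness turns the radii of local convexity into a single one. *)
Lemma uniform_local_convexity K : compact K ->
  (forall x, K x -> exists2 e, 0 < e & seg_convex (K `&` ball x e)) ->
  exists2 e, 0 < e & forall x y, K x -> K y -> `|x - y| <= e -> segment x y `<=` K.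
Proof.
move=> /compact_near_coveringP/near_covering_withinP cK lK.
have H : \forall e \near (0 : R)^'+, K `<=` fun x =>
    forall y, K y -> `|x - y| <= e -> segment x y `<=` K.
  apply: cK => x Kx; have [d d0 Kd] := lK x Kx.
  near=> x' e => Kx' y Ky x'y.
  have xx' : ball x (d / 2) x' by near: x'; exact/nbhsx_ballx/divr_gt0.
  rewrite -ball_normE /= in xx'.
  have ed : e < d / 2 by near: e; apply: nbhs_right_lt; rewrite divr_gt0.
  move=> z x'yz; suff [] : (K `&` ball x d) z by [].
  apply: Kd x'yz; split=> //; rewrite -ball_normE /=.
    by rewrite (lt_trans xx') // ltr_pdivrMr // ltr_pMr // ltr1n.
  rewrite -[x](subrK x') -addrA (le_lt_trans (ler_normD _ _)) // [d]splitr.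
  by rewrite ltrD // (le_lt_trans x'y).
have [e [e0 He]] : exists e, 0 < e /\ K `<=` fun x =>
    forall y, K y -> `|x - y| <= e -> segment x y `<=` K.
  apply: (@filter_ex _ (0 : R)^'+); apply: filterI; last exact: H.
  exact: nbhs_right_gt.
by exists e => // x y Kx; exact: He.
Unshelve. all: end_near. Qed.

Definition chain K e x y := exists N (f : nat -> plane R),
  [/\ f 0%N = x, f N = y, forall i, K (f i) &
      forall i, (i < N)%N -> `|f i - f i.+1| <= e].

(** The points that a chain can reach form an open and closed subset of [K]. *)
Lemma connected_chain K e x y : connected K -> 0 < e -> K x -> K y -> chain K e x y.
Proof.
move=> cK e0 Kx Ky; pose B := [set z | K z /\ chain K e x z].
have extend z t : B z -> K t -> `|z - t| < e -> B t.
  move=> [Kz [N [f [f0 fN fK fe]]]] Kt zt; split=> //.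
  exists N.+1, (fun i => if (i <= N)%N then f i else t); split=> //.
  - by rewrite ltnn.
  - by move=> i; case: ifP.
  - move=> i; rewrite ltnS => iN; rewrite iN; case: (ltnP i N) => [/fe //|Ni].
    have -> : i = N by apply/eqP; rewrite eqn_leq iN.
    by rewrite fN ltW.
suff KB : B = K by have [] : B y by rewrite KB.
apply: cK.
- exists x; split=> //; exists 0%N, (fun=> x); split=> //.
- exists (\bigcup_(z in B) ball z e); first by apply: bigcup_open => z _; exact: ball_open.
  apply/seteqP; split=> [z Bz|z [Kz [t Bt]]].
    by split; [case: Bz|exists z => //; exact: ballxx].
  by rewrite -ball_normE; exact: extend.
- exists (~` \bigcup_(z in K `\` B) ball z e).
    by apply: open_closedC; apply: bigcup_open => z _; exact: ball_open.
  apply/seteqP; split=> [z Bz|z [Kz nz]].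
    split; first by case: Bz.
    move=> [t [Kt nBt]]; rewrite -ball_normE /= distrC => zt.
    by apply: nBt; exact: extend zt.
  by apply: contrapT => nBz; apply: nz; exists z; [split|exact: ballxx].
Qed.

(** Two steps from [u] to [v] have least energy when they are equal; the last term
is the excess. *)
Lemma parallelogram (u v m : plane R) :
  dot (u - m) (u - m) + dot (m - v) (m - v) =
  2^-1 * dot (u - v) (u - v) + 2 * dot (m - 2^-1 *: (u + v)) (m - 2^-1 *: (u + v)).
Proof. by rewrite /dot /= /GRing.scale /=; field. Qed.

Let energy N (f : nat -> plane R) := \sum_(i < N) dot (f i - f i.+1) (f i - f i.+1).

(** The endpoints are fixed by one-point factors, which makes the first part a
product of compact sets; the values beyond [N] are fillers. *)
Let chains K e x y N : set (nat -> plane R) :=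
  [set f | forall i, (if i == 0%N then [set x] else if i == N then [set y] else K) (f i)]
  `&` \bigcap_(i < N) [set f | `|f i - f i.+1| <= e].

Let continuous_dot : continuous (fun v : plane R => dot v v).
Proof.
by move=> v; apply: cvgD; apply: cvgM; (try exact: cvg_fst); exact: cvg_snd.
Qed.

Let continuous_sum (T : topologicalType) N (f : 'I_N -> T -> R) :
  (forall i, continuous (f i)) -> continuous (fun t => \sum_(i < N) f i t).
Proof.
by move=> cf t; apply: (cvg_big add_continuous) => i _; exact: cf.
Qed.

(** The chains form a compact set by Tychonoff's theorem. *)
Lemma minimal_chain K e x y N : compact K -> (0 < N)%N -> chains K e x y N !=set0 ->
  exists2 f, chains K e x y N f &
    forall g, chains K e x y N g -> energy N f <= energy N g.
Proof.
move=> cK N0 ne.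
pose A (i : nat) := if i == 0%N then [set x] else if i == N then [set y] else K.
have coordC (i : nat) : continuous (fun f : prod_topology (fun _ : nat => plane R) => f i).
  by move=> f; exact: (@proj_continuous nat (fun=> plane R) i f).
have diffC (i : nat) : continuous (fun f : prod_topology (fun _ : nat => plane R) =>
    f i - f i.+1).
  by move=> f; exact: (cvgB (coordC i f) (coordC i.+1 f)).
have cC : @compact (prod_topology (fun _ : nat => plane R)) (chains K e x y N).
  apply: compact_closedI.
    apply: (@tychonoff nat (fun=> plane R) A) => i; rewrite /A.
    by case: ifP => _; [exact: compact_set1|case: ifP => _ //; exact: compact_set1].
  apply: closed_bigI => i _.
  apply: (@preimage_closed _ _ (fun f : prod_topology (fun _ : nat => plane R) =>
    `|f i - f i.+1|) [set r | r <= e]); last exact: closed_le.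
  by move=> f _; apply: (continuous_comp (diffC i f)); exact: norm_continuous.
have [|f] := @compact_EVT_min (prod_topology (fun _ : nat => plane R)) R
  (energy N) (chains K e x y N) ne cC.
  apply: continuous_subspaceT; apply: (@continuous_sum (prod_topology (fun _ : nat => plane R))
    N (fun i f => dot (f i - f i.+1) (f i - f i.+1))) => i f.
  exact: (@continuous_comp (prod_topology (fun _ : nat => plane R)) _ _
    (fun f => f i - f i.+1) (fun v => dot v v) f (diffC i f) (@continuous_dot _)).
rewrite inE => Cf min; exists f => // g Cg; apply: min; rewrite inE //.
Qed.

(** Moving [f i.+1] to the midpoint of its neighbours keeps the steps short and
lowers the energy. *)
Lemma minimal_chain_midpoint K e x y N f : K x -> K y ->
  (forall x y, K x -> K y -> `|x - y| <= 2 * e -> segment x y `<=` K) ->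
  chains K e x y N f ->
  (forall g, chains K e x y N g -> energy N f <= energy N g) ->
  forall i, (i.+1 < N)%N -> f i.+1 = 2^-1 *: (f i + f i.+2).
Proof.
move=> Kx Ky uK [fA fe] min i iN; set m := 2^-1 *: _.
have Kf j : K (f j).
  by move: (fA j); case: ifP => _; [move=> /= ->|case: ifP => _ // /= ->].
have fie j : (j < N)%N -> `|f j - f j.+1| <= e by move=> jN; exact: (fe j).
pose g j := if j == i.+1 then m else f j.
have fi2 : `|f i - f i.+2| <= 2 * e.
  rewrite mulr_natl mulr2n -[f i](subrK (f i.+1)) -addrA.
  by rewrite (le_trans (ler_normD _ _)) // lerD // fie // ltnW.
have Cg : chains K e x y N g.
  split=> [j|j jN]; rewrite /g /=.
    have [->|_] := eqVneq j i.+1; last exact: fA.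
    rewrite /= (ltn_eqF iN).
    apply: (uK (f i) (f i.+2)) => //; exists 2^-1.
      by rewrite /= in_itv/= invr_ge0 ler0n invf_le1 ?ler1n ?ltr0n.
    by apply/pair_equal_spec; rewrite /= /GRing.scale /=; split; field.
  have [ji|_] := eqVneq j i.+1.
    rewrite ji gtn_eqF //.
    have -> : m - f i.+2 = 2^-1 *: (f i - f i.+2).
      by apply/pair_equal_spec; rewrite /= /GRing.scale /=; split; field.
    by rewrite normrZ gtr0_norm ?invr_gt0 // mulrC ler_pdivrMr // mulrC.
  have [[ji]|_] := eqVneq j.+1 i.+1; last exact: fe.
  rewrite ji.
  have -> : f i - m = 2^-1 *: (f i - f i.+2).
    by apply/pair_equal_spec; rewrite /= /GRing.scale /=; split; field.
  by rewrite normrZ gtr0_norm ?invr_gt0 // mulrC ler_pdivrMr // mulrC.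
have := min g Cg; rewrite /energy.
have iN' := ltn_trans (ltnSn i) iN.
rewrite (bigD1 (Ordinal iN')) //= (bigD1 (Ordinal iN)) /=; last first.
  by rewrite -val_eqE /= gtn_eqF.
rewrite [leRHS](bigD1 (Ordinal iN')) //= [X in _ <= _ + X](bigD1 (Ordinal iN)) /=; last first.
  by rewrite -val_eqE /= gtn_eqF.
rewrite !(addrA (dot _ _) (dot _ _))
  [X in _ <= _ + X](eq_bigr (fun j : 'I_N => dot (f j - f j.+1) (f j - f j.+1)));
  last first.
  move=> j /andP[]; rewrite -!val_eqE /= /g eqSS => /negPf -> /negPf -> //.
rewrite lerD2r /g eqxx (ltn_eqF (ltnSn i)) (gtn_eqF (ltnSn i.+1)).
rewrite !parallelogram -/m lerD2l subrr => le.
apply/subr0_eq/dot_eq0/le_anti; rewrite dot_ge0 andbT.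
have E0 : dot (0 : plane R) 0 = 0 by rewrite /dot /=; ring.
by move: le; rewrite E0 mulr0 pmulr_rle0.
Qed.

Lemma minimal_chain_arith f N :
  (forall i, (i.+1 < N)%N -> f i.+1 = 2^-1 *: (f i + f i.+2)) ->
  forall i, (i <= N)%N -> f i = f 0%N + i%:R *: (f 1%N - f 0%N) :> plane R.
Proof.
move=> H; have step i : (i < N)%N -> f i.+1 = f i + (f 1%N - f 0%N).
  elim: i => [|i IH] iN; first by rewrite addrC subrK.
  have := H i iN; rewrite {1}IH ?(ltnW iN) // => E.
  have {}E : f i.+2 = 2 *: (f i + (f 1%N - f 0%N)) - f i.
    by rewrite E scalerA divff // scale1r addrC addKr.
  rewrite E IH ?(ltnW iN) // scaler_nat mulr2n.
  by rewrite [LHS]addrAC [X in X + _]addrAC subrr add0r addrC.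
elim=> [|i IH] iN; first by rewrite scale0r addr0.
by rewrite step // IH ?(ltnW iN) // -addrA -natr1 scalerDl scale1r.
Qed.

(** The theorem of Tietze and Nakajima. In a chain of least energy each inner
point is the midpoint of its neighbours, so the chain runs along the straight
segment, and its steps are short enough to lie in [K]. *)
Theorem locally_convex_convex K : compact K -> connected K ->
  (forall x, K x -> exists2 e, 0 < e & seg_convex (K `&` ball x e)) ->
  seg_convex K.
Proof.
move=> cptK cnK lK x y Kx Ky.
have [d d0 uK] := uniform_local_convexity cptK lK.
pose e := d / 2; have e0 : 0 < e by rewrite divr_gt0.
have {}uK u v : K u -> K v -> `|u - v| <= 2 * e -> segment u v `<=` K.
  by move=> Ku Kv uv; apply: uK => //; move: uv; rewrite /e mulrC divfK.
have [N [f [f0 fN fK fe]]] := connected_chain cnK e0 Kx Ky.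
have [N0|N0] := posnP N.
  by rewrite -fN -f0 N0; apply: uK => //; rewrite subrr normr0 mulr_ge0 // ltW.
have ne : chains K e x y N !=set0.
  exists f; split=> [i|i iN]; last exact: fe.
  by case: eqP => [->//|_]; case: eqP => [->//|].
have {ne} [g Cg gmin] := minimal_chain cptK N0 ne.
have gA := minimal_chain_arith (minimal_chain_midpoint Kx Ky uK Cg gmin).
have gK i : K (g i).
  by have := Cg.1 i; case: ifP => _; [move=> ->|case: ifP => _ // ->].
have g0 : g 0%N = x by exact: (Cg.1 0%N).
have gN : g N = y by have := Cg.1 N; rewrite gtn_eqF // eqxx.
set v := g 1%N - g 0%N in gA.
move=> _ [t /= /itvP t01 <-].
have -> : (1 - t) *: x + t *: y = x + (t * N%:R) *: v.
  rewrite -gN (gA N (leqnn N)) g0 scalerDr addrA -scalerDl subrK scale1r.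
  by rewrite scalerA.
have tN : 0 <= t * N%:R by rewrite mulr_ge0 // t01.
have i_le : (Num.truncn (t * N%:R))%:R <= t * N%:R by rewrite truncn_le.
have i_lt : t * N%:R < (Num.truncn (t * N%:R)).+1%:R by rewrite truncnS_gt.
set i := Num.truncn _ in i_le i_lt.
have : (i <= N)%N.
  rewrite -(ler_nat R) (le_trans i_le) // ler_piMl ?t01 //.
rewrite leq_eqVlt => /predU1P[iN|iN].
  suff -> : t * N%:R = N%:R by rewrite -g0 -gA // gN.
  by move: i_le; rewrite iN => i_le; apply/le_anti; rewrite i_le ler_piMl ?t01.
apply: (uK (g i) (g i.+1)) => //.
  have := Cg.2 i iN; move=> /= /le_trans; apply.
  by rewrite ler_peMl ?ler1n ?ltW.
rewrite segmentE; exists (t * N%:R - i%:R).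
  by rewrite /= in_itv/= subr_ge0 i_le lerBlDl natr1 ltW.
have -> : g i.+1 - g i = v.
  by rewrite (gA i.+1) // (gA i (ltnW iN)) -natr1 scalerDl scale1r addrA [LHS]addrAC subrr add0r.
by rewrite (gA i (ltnW iN)) g0 -addrA -scalerDl [i%:R + _]addrC subrK.
Qed.

End LocalConvexity.

(** * The filled polygon *)

Section BoundaryTopology.
Context {R : realType} {n : nat}.
Variable P : 'I_n -> plane R.
Implicit Types (i j : 'I_n) (x y : plane R).

Lemma hausdorff_plane : hausdorff_space (plane R).
Proof. exact: norm_hausdorff. Qed.

Lemma closed_edge i : closed (edge P i).
Proof. exact: (compact_closed hausdorff_plane (@compact_segment R _ _)). Qed.

Lemma near_edge x : \forall y \near x, forall j, edge P j y -> edge P j x.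
Proof.
apply: (@filter_forall _ _ (fun j y => edge P j y -> edge P j x) (nbhs x)) => j.
have [xj|xj] := pselect (edge P j x).
  by near=> y.
have : open (~` edge P j) by apply: closed_openC; exact: closed_edge.
by rewrite openE => /(_ x xj); apply: filterS => y /= yj /yj.
Unshelve. all: end_near. Qed.

Lemma near_notin_boundary x : ~ boundary P x -> \forall y \near x, ~ boundary P y.
Proof.
move=> xP; have := near_edge x; apply: filterS => y yx [j _ /yx xj].
by apply: xP; exists j.
Qed.

Lemma compact_boundary : compact (boundary P).
Proof.
have -> : boundary P = \big[setU/set0]_(i < n) edge P i.
  rewrite -bigcup_seq; apply/seteqP; split=> x [i _ xi]; exists i => //=.
  exact: mem_index_enum.
by apply: bigsetU_compact => i _; exact: compact_segment.
Qed.

(** A small ball off the curve lies in a single component of its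
complement. *)
Lemma near_same_side x : ~ boundary P x ->
  \forall y \near x, inside P y <-> inside P x.
Proof.
move=> /near_notin_boundary /nbhs_ballP [e /= e0 xe].
near=> y; have xy : ball x e y by near: y; exact: nbhsx_ballx.
have cb := connected_seg_convex (@seg_convex_ball R x e).
have xx := ballxx x e0.
by split; apply: (inside_connected cb xe).
Unshelve. all: end_near. Qed.

Lemma near_inside x : inside P x -> \forall y \near x, inside P y.
Proof.
by move=> Px; have := near_same_side Px.1; apply: filterS => y [_]; exact.
Qed.

Definition filled : set (plane R) := inside P `|` boundary P.

Lemma closed_filled : closed filled.
Proof.
rewrite -openC openE => x /not_orP [nix nbx].
near=> y; apply/not_orP; split; last by near: y; exact: near_notin_boundary.
have yx : inside P y <-> inside P x by near: y; exact: near_same_side.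
by move=> /yx.
Unshelve. all: end_near. Qed.

(** From a point farther out than the whole curve, the ray pointing away from the
origin misses the curve. *)
Lemma bounded_filled : bounded_set filled.
Proof.
have /compact_bounded/bounded_setP [M bM] := compact_boundary.
apply/bounded_setP; exists `|M| => x Kx; rewrite leNgt; apply/negP => Mx.
have x0 : 0 < `|x| by exact: le_lt_trans Mx.
have ray t : 0 <= t -> ~ boundary P (x + t *: x).
  move=> t0 /bM; rewrite -{1}[x]scale1r -scalerDl normrZ ger0_norm ?addr_ge0 //.
  apply/negP; rewrite -ltNge (le_lt_trans (ler_norm M)) // (lt_le_trans Mx) //.
  by rewrite ler_peMl // lerDl.
case: Kx => [|/bM]; first by apply: (ray_not_inside (v := x)) ray; rewrite -normr_gt0.
by apply/negP; rewrite -ltNge (le_lt_trans (ler_norm M)).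
Qed.

Lemma compact_filled : compact filled.
Proof.
have /bounded_setP [M KM] := bounded_filled.
apply: (subclosed_compact closed_filled (compact_setX (@segment_compact R (- M) M)
  (@segment_compact R (- M) M))) => x /KM xM.
by split; rewrite /= in_itv /= -ler_norml (le_trans _ xM) // /Num.norm /= le_max lexx ?orbT.
Qed.

Lemma iter_ordS (i : 'I_n) k : iter k (@ordS n) i = ((i + k) %% n)%N :> nat.
Proof.
elim: k => [|k IH] /=; first by rewrite addn0 modn_small.
by rewrite IH addnS -addn1 modnDml addn1.
Qed.

Lemma ord_cyclic_ind (Q : 'I_n -> Prop) i0 :
  Q i0 -> (forall i, Q i -> Q (ordS i)) -> forall i, Q i.
Proof.
(* After [n - i0] steps from [i0] one is at 0. *)
move=> Q0 QS i; have -> : i = iter (i + (n - i0))%N (@ordS n) i0.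
  apply/val_inj => /=; rewrite iter_ordS addnCA subnKC ?(ltnW (ltn_ord i0)) //.
  by rewrite modnDr modn_small.
by elim: (_ + _)%N => //= k; exact: QS.
Qed.

Lemma connected_boundary : connected (boundary P).
Proof.
have [[i0 _]|nI] := pselect (exists i : 'I_n, True); last first.
  suff -> : boundary P = set0 by exact: connected0.
  by rewrite -subset0 => x [i]; case: nI; exists i.
pose B k := \bigcup_(j in `I_k.+1) edge P (iter j (@ordS n) i0).
have BS k : B k.+1 = B k `|` edge P (iter k.+1 (@ordS n) i0).
  apply/seteqP; split=> [x [j /=]|x [[j /= jk xj]|xk]].
  - by rewrite ltnS leq_eqVlt => /predU1P[->|jk] xj; [right|left; exists j].
  - by exists j => //=; exact: leqW.
  - by exists k.+1 => /=.
have cB k : connected (B k).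
  elim: k => [|k IH].
    have -> : B 0%N = edge P i0 by rewrite /B bigcup_mkord big_ord1.
    exact: connected_segment.
  rewrite BS; apply: connectedU => //; last exact: connected_segment.
  exists (P (iter k.+1 (@ordS n) i0)); split; last exact: segment_left.
  by exists k; [exact: ltnSn|exact: segment_right].
have -> : boundary P = \bigcup_k B k.
  apply/seteqP; split=> [x [i _ xi]|x [k _ [j _ xj]]]; last by exists (iter j (@ordS n) i0).
  suff [k ik] : exists k, i = iter k (@ordS n) i0.
    by exists k => //; exists k; [exact: ltnSn|rewrite -ik].
  move: i {xi}; apply: (ord_cyclic_ind (i0 := i0)); first by exists 0%N.
  by move=> i [k ->]; exists k.+1.
apply: bigcup_connected => [|k _]; last exact: cB.
by exists (P i0) => k _; exists 0%N => //=; exact: segment_left.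
Qed.

(** The segment is the part of a horizontal ray up to its first point on the
curve. *)
Lemma segment_to_boundary x : inside P x ->
  exists2 z, boundary P z & segment x z `<=` filled.
Proof.
move=> Px; pose v : plane R := (1, 0).
have v0 : v != 0 by rewrite -pair_eqE /= oner_eq0.
have [t1 t1_ge0 bt1] : exists2 t, 0 <= t & boundary P (x + t *: v).
  apply: contrapT => nt; move: Px; apply: (ray_not_inside v0) => t t0 bt.
  by apply: nt; exists t.
pose T := `[0, t1] `&` [set t | boundary P (x + t *: v)].
have cT : compact T.
  apply: compact_closedI; first exact: segment_compact.
  apply: (@preimage_closed _ _ (fun t : R => x + t *: v) (boundary P)).
    by move=> t _; exact: continuous_line.
  exact: (compact_closed hausdorff_plane compact_boundary).
have T0 : T !=set0 by exists t1; split=> //=; rewrite in_itv/= t1_ge0 lexx.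
have [|t0] := compact_EVT_min T0 cT (f := idfun).
  by apply: continuous_subspaceT => t; exact: cvg_id.
rewrite inE => -[/= /itvP t01 bt0] t0_min; exists (x + t0 *: v) => //.
have below t : 0 <= t -> t < t0 -> ~ boundary P (x + t *: v).
  move=> t_ge0 tt0 bt; have : t \in T.
    by rewrite inE; split=> //=; rewrite in_itv/= t_ge0 (le_trans (ltW tt0)) // t01.
  by move=> /t0_min /=; rewrite leNgt tt0.
rewrite segmentE => _ [s /= /itvP s01 <-]; rewrite [x + t0 *: v - x]addrC addKr scalerA.
have [->|s1] := eqVneq s 1; first by rewrite mul1r; right.
have [t00|t0_neq0] := eqVneq t0 0.
  by rewrite t00 mulr0 scale0r addr0; left.
have t0_gt0 : 0 < t0 by rewrite lt_def t0_neq0 t01.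
left; apply: (@inside_connected _ _ P ((fun t => x + t *: v) @` `[0, t0[) x) => //.
- apply: connected_continuous_connected.
    by apply/connected_intervalP; exact: interval_is_interval.
  by apply: continuous_subspaceT; exact: continuous_line.
- by move=> _ [t /= /itvP t0t <-]; apply: below; rewrite t0t.
- by exists 0; rewrite ?scale0r ?addr0 //= in_itv/= lexx.
- exists (s * t0) => //=; rewrite in_itv/= mulr_ge0 ?s01 ?(ltW t0_gt0) //=.
  by rewrite gtr_pMl // lt_neqAle s1 s01.
Qed.

(** The boundary is connected and every inner point is linked to it by a
segment. *)
Lemma connected_filled : connected filled.
Proof.
have [[i0 _]|nI] := pselect (exists i : 'I_n, True); last first.
  suff -> : filled = set0 by exact: connected0.
  rewrite -subset0 => x [/segment_to_boundary [z [i]]|[i]];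
  by case: nI; exists i.
have reach x : filled x -> exists C, [/\ connected C, C x, C `<=` filled & boundary P `<=` C].
  case=> [Px|bx]; last first.
    by exists (boundary P); split=> //; [exact: connected_boundary|right].
  have [z bz xz] := segment_to_boundary Px; exists (segment x z `|` boundary P); split.
  - apply: connectedU; [|exact: connected_segment|exact: connected_boundary].
    by exists z; split=> //; exact: segment_right.
  - by left; exact: segment_left.
  - by move=> y [/xz|by_] //; right.
  - by move=> y; right.
have -> : filled = \bigcup_(C in [set C | [/\ connected C, C `<=` filled & boundary P `<=` C]]) C.
  apply/seteqP; split=> x; last by move=> [C [_ CK _]]; exact: CK.
  by move=> /reach [C [? ? ? ?]]; exists C.
apply: bigcup_connected => [|C []//].
exists (P i0) => C [_ _]; apply; exists i0 => //; exact: segment_left.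
Qed.

End BoundaryTopology.

(** * The curve near an edge *)

Lemma near_shift (R : realType) (x v : plane R) (Q : plane R -> Prop) :
  (\forall y \near x, Q y) ->
  \forall t \near (0 : R)^'+, Q (x + t *: v).
Proof.
have : (fun t : R => x + t *: v) t @[t --> (0 : R)^'+] --> x.
  apply: cvg_at_right_filter; rewrite -[X in _ --> X](addr0 x) -(scale0r v).
  exact: continuous_line.
by move=> H /H.
Qed.

Section LocalStructure.
Context {R : realType} {n : nat}.
Variable P : 'I_n -> plane R.
Hypothesis n_ge3 : (3 <= n)%N.
Hypothesis sP : simple_polygon P.
Hypothesis cP : convex_polygon P.
Implicit Types (i j : 'I_n) (x y : plane R) (c : R).

Let Pinj : injective P. Proof. by case: sP. Qed.

Definition turn i : R := orient (P (ord_pred i)) (P i) (P (ordS i)).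

Lemma turn_neq0 i : turn i != 0.
Proof. by have [] := convex_vertex n_ge3 sP cP i. Qed.

Lemma side_pred_turn c i : side c P (ord_pred i) (P (ordS i)) = c * turn i.
Proof. by rewrite /side ord_predK. Qed.

Lemma side_next_turn c i : side c P i (P (ord_pred i)) = c * turn i.
Proof. by rewrite /side /turn /orient /cross /=; ring. Qed.

Definition open_edge i x := exists2 s, 0 < s < 1 & x = (1 - s) *: P i + s *: P (ordS i).

Lemma open_edge_edge i x : open_edge i x -> edge P i x.
Proof.
by move=> [s /andP[s0 s1] ->]; exists s => //=; rewrite in_itv/= !ltW.
Qed.

(** Two edges of a simple polygon meet in common endpoints only. *)
Lemma open_edge_unique i j x : open_edge i x -> edge P j x -> j = i.
Proof.
move=> xi xj; have [_ _ sPP] := sP; have [//|ji] := eqVneq j i.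
have ne : P (ordS i) - P i != 0 by rewrite subr_eq0 (inj_eq Pinj) ordS_neq.
have [s /andP[s0 s1] xE] := xi.
have endpoint y : y = (1 - s) *: P i + s *: P (ordS i) -> y <> P i /\ y <> P (ordS i).
  move=> ->; split=> /eqP; rewrite -subr_eq0.
    have -> : (1 - s) *: P i + s *: P (ordS i) - P i = s *: (P (ordS i) - P i).
      by apply/pair_equal_spec; rewrite /= /GRing.scale /=; split; ring.
    by rewrite scaler_eq0 (negPf ne) gt_eqF.
  have -> : (1 - s) *: P i + s *: P (ordS i) - P (ordS i) = (s - 1) *: (P (ordS i) - P i).
    by apply/pair_equal_spec; rewrite /= /GRing.scale /=; split; ring.
  by rewrite scaler_eq0 (negPf ne) orbF subr_eq0 lt_eqF.
have [nV nC] := endpoint x xE; rewrite eq_sym in ji.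
by have [[jE xP]|[iE xP]] := sPP i j ji x (open_edge_edge xi) xj;
  [case: nC; rewrite xP jE|case: nV].
Qed.

Lemma near_open_edge_side c i x : open_edge i x ->
  \forall y \near x, boundary P y -> side c P i y = 0.
Proof.
move=> xi; have := near_edge P x; apply: filterS => y yx [j _ yj].
by have := yx j yj => /(open_edge_unique xi) ij; rewrite ij in yj; exact: edge_side.
Qed.

Lemma near_open_edge_boundary c i x : c != 0 -> open_edge i x ->
  \forall y \near x, side c P i y = 0 -> boundary P y.
Proof.
move=> c0 [s /andP[s0 s1] xE].
have d0 : orient (P (ord_pred i)) (P i) (P (ordS i)) != 0 := turn_neq0 i.
pose f y := orient (P (ord_pred i)) (P i) y / orient (P (ord_pred i)) (P i) (P (ordS i)).
have cf : {for x, continuous f} by apply: cvgMr_tmp; exact: continuous_orient.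
have fx : f x = s.
  by rewrite /f xE orient_conv orientpqq mulr0 add0r mulfK.
have f_gt0 : \forall y \near x, 0 < f y by apply: near_gt0; rewrite ?fx.
have f_lt1 : \forall y \near x, f y < 1.
  by apply: (@cvgr_lt _ _ (nbhs x) _ f (f x) cf 1); rewrite fx.
near=> y => /eqP; rewrite mulf_eq0 (negPf c0) /= => /eqP /line_param /(_ d0) yE.
exists i => //; exists (f y) => //=; rewrite in_itv/=.
by apply/andP; split; apply: ltW; near: y.
Unshelve. all: end_near. Qed.

(** The sign of [c] selects one of the two sides of the edge [i] at [x]. *)
Definition inner_side c i x := \forall y \near x, 0 < side c P i y -> inside P y.
Definition outer_side c i x := \forall y \near x, 0 < side c P i y -> ~ inside P y.

(** The half ball on one side of an open edge is connected and misses the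
curve. *)
Lemma inner_or_outer c i x : open_edge i x -> inner_side c i x \/ outer_side c i x.
Proof.
move=> xi; have /nbhs_ballP [e /= e0 xe] := near_open_edge_side c xi.
have xx := nbhsx_ballx x e e0.
pose C := ball x e `&` [set y | 0 < side c P i y].
have cC : connected C.
  apply: connected_seg_convex; apply: seg_convexI; first exact: seg_convex_ball.
  exact: seg_convex_gt.
have Cb : C `<=` ~` boundary P by move=> y [/xe yb /= y0 /yb yi]; rewrite yi ltxx in y0.
have [[z [Cz Pz]]|nz] := pselect (exists z, C z /\ inside P z); [left|right].
  by apply: filterS xx => y xy y0; exact: (inside_connected cC Cb Cz).
by apply: filterS xx => y xy y0 Py; apply: nz; exists y.
Qed.

(** Pushes a point off the line through edge [i], to the side where [side c]
is positive. *)
Definition normal c i : plane R :=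
  (- (c * (P (ordS i) - P i).2), c * (P (ordS i) - P i).1).

Lemma side_normal c i x t : side c P i (x + t *: normal c i) =
  side c P i x + t * (c ^+ 2 * dot (P (ordS i) - P i) (P (ordS i) - P i)).
Proof. by rewrite sideD /cross /normal /dot /=; ring. Qed.

Lemma normal_gt0 c i : c != 0 ->
  0 < c ^+ 2 * dot (P (ordS i) - P i) (P (ordS i) - P i).
Proof.
move=> c0; apply: mulr_gt0; first by rewrite exprn_even_gt0.
by apply: dot_gt0; rewrite subr_eq0 (inj_eq Pinj) ordS_neq.
Qed.

Lemma side_not_both c i x : c != 0 -> open_edge i x ->
  inner_side c i x -> outer_side c i x -> False.
Proof.
move=> c0 xi /(near_shift (normal c i)) xin /(near_shift (normal c i)) xout.
suff [t [t0 [tin tout]]] : exists t, 0 < t /\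
    (0 < side c P i (x + t *: normal c i) -> inside P (x + t *: normal c i)) /\
    (0 < side c P i (x + t *: normal c i) -> ~ inside P (x + t *: normal c i)).
  have tx : 0 < side c P i (x + t *: normal c i).
    by rewrite side_normal (edge_side _ (open_edge_edge xi)) add0r mulr_gt0 // normal_gt0.
  exact: tout tx (tin tx).
apply: (@filter_ex _ (0 : R)^'+); apply: filterI; first exact: nbhs_right_gt.
exact: filterI.
Qed.

(** By compactness of the segment from [x] to [x'], a small parallel translate of
it misses the curve. *)
Lemma inner_side_edge c i x x' : c != 0 -> open_edge i x -> open_edge i x' ->
  inner_side c i x -> inner_side c i x'.
Proof.
move=> c0 xi x'i xin; have [//|xout] := inner_or_outer c x'i; exfalso.
pose v := normal c i.
have seg z : segment x x' z -> open_edge i z.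
  move=> [t /= /itvP t01 <-]; have [s /andP[s0 s1] ->] := xi.
  have [r /andP[r0 r1] ->] := x'i; exists ((1 - t) * s + t * r); last first.
    by apply/pair_equal_spec; rewrite /= /GRing.scale /=; split; ring.
  have t0 : 0 <= t by rewrite t01.
  have t1 : t <= 1 by rewrite t01.
  have [->|t_neq0] := eqVneq t 0; first by rewrite subr0 mul1r mul0r addr0 s0.
  have : 0 < t by rewrite lt_def t_neq0.
  by move=> t_gt0; apply/andP; split; nra.
have off z t : segment x x' z -> 0 < t -> 0 < side c P i (z + t *: v).
  move=> /seg /open_edge_edge /(edge_side c) zi t0.
  by rewrite side_normal zi add0r mulr_gt0 // normal_gt0.
have /compact_near_coveringP/near_covering_withinP cseg := @compact_segment R x x'.
have H : \forall t \near (0 : R)^'+,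
    segment x x' `<=` fun z => 0 < t -> ~ boundary P (z + t *: v).
  apply: cseg => z zx; have /nbhs_ballP [e /= e0 ze] := near_open_edge_side c (seg z zx).
  have e20 : 0 < e / 2 by rewrite divr_gt0.
  near=> z' t => z'x t0 bz; have := off z' t z'x t0.
  rewrite (ze _ _ bz) ?ltxx // -ball_normE /= opprD addrA.
  have zz' : ball z (e / 2) z' by near: z'; exact: nbhsx_ballx.
  have tv : ball 0 (e / 2) (0 + t *: v).
    by near: t; apply: (near_shift v); exact: nbhsx_ballx.
  move: zz' tv; rewrite -!ball_normE /= !add0r normrN => zz' tv.
  by rewrite (le_lt_trans (ler_normD _ _)) // normrN [e]splitr ltrD.
have [t [t0 [Ht [tin tout]]]] : exists t, 0 < t /\
    (segment x x' `<=` fun z => 0 < t -> ~ boundary P (z + t *: v)) /\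
    (0 < side c P i (x + t *: v) -> inside P (x + t *: v)) /\
    (0 < side c P i (x' + t *: v) -> ~ inside P (x' + t *: v)).
  apply: (@filter_ex _ (0 : R)^'+); apply: filterI; first exact: nbhs_right_gt.
  by apply: filterI => //; apply: filterI; [exact: near_shift xin|exact: near_shift xout].
have xx := segment_left x x'; have xx' := segment_right x x'.
apply: (tout (off _ _ xx' t0)).
apply: (@inside_connected _ _ P ((fun z => z + t *: v) @` segment x x') (x + t *: v)) => //.
- apply: connected_continuous_connected; first exact: connected_segment.
  apply: continuous_subspaceT => z; apply: cvgD; [exact: cvg_id|exact: cvg_cst].
- by move=> _ [z zx <-]; exact: Ht.
- by exists x.
- by exists x'.
- exact: tin (off _ _ xx t0).
Unshelve. all: end_near. Qed.

End LocalStructure.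

(** * The curve near a vertex *)

Section Vertices.
Context {R : realType} {n : nat}.
Variable P : 'I_n -> plane R.
Hypothesis n_ge3 : (3 <= n)%N.
Hypothesis sP : simple_polygon P.
Hypothesis cP : convex_polygon P.
Implicit Types (i j : 'I_n) (x y : plane R) (c : R).

Let Pinj : injective P. Proof. by case: sP. Qed.

(** In the coordinates given by the sides of its two edges, the curve near a vertex
is the boundary of the first quadrant, by this lemma and the next one. *)
Lemma near_vertex_boundary c i : 0 < c * turn P i -> \forall y \near P i,
  boundary P y -> [/\ 0 <= side c P (ord_pred i) y, 0 <= side c P i y &
    side c P (ord_pred i) y = 0 \/ side c P i y = 0].
Proof.
move=> ci; have [_ _ sPP] := sP; have := near_edge P (P i).
apply: filterS => y yV [j _ yj]; have Vj := yV j yj.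
have pE : P (ordS (ord_pred i)) = P i by rewrite ord_predK.
have [ji|ji] := eqVneq j i.
  rewrite ji in yj; have yi := edge_side c yj; split; rewrite ?yi //; last by right.
  apply: segment_ge0 yj => [t||]; first by rewrite side_conv.
    by rewrite -pE side_right.
  by rewrite side_pred_turn ltW.
have jp : j = ord_pred i.
  have [[iSj _]|[jSi xP]] := sPP j i ji (P i) Vj (segment_left _ _).
    by rewrite iSj ordSK.
  by move/Pinj: xP => ij; rewrite ij eqxx in ji.
rewrite jp in yj; have yp := edge_side c yj; split; rewrite ?yp //; last by left.
apply: segment_ge0 yj => [t||]; first by rewrite side_conv.
  by rewrite side_next_turn ltW.
by rewrite pE side_left.
Qed.

Lemma near_vertex_boundary_of_side c i : 0 < c * turn P i -> \forall y \near P i,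
  0 <= side c P (ord_pred i) y -> 0 <= side c P i y ->
  side c P (ord_pred i) y = 0 \/ side c P i y = 0 -> boundary P y.
Proof.
move=> ci; have c0 : c != 0 by apply: contraTneq ci => ->; rewrite mul0r ltxx.
have pE : P (ordS (ord_pred i)) = P i by rewrite ord_predK.
pose f y := side c P (ord_pred i) y / (c * turn P i).
pose g y := side c P i y / (c * turn P i).
have cf : {for P i, continuous f} by apply: cvgMr_tmp; exact: continuous_side.
have cg : {for P i, continuous g} by apply: cvgMr_tmp; exact: continuous_side.
have f_lt1 : \forall y \near P i, f y < 1.
  apply: (@cvgr_lt _ _ (nbhs (P i)) _ f (f (P i)) cf 1).
  by rewrite /f -{1}pE side_right mul0r.
have g_lt1 : \forall y \near P i, g y < 1.
  apply: (@cvgr_lt _ _ (nbhs (P i)) _ g (g (P i)) cg 1).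
  by rewrite /g side_left mul0r.
near=> y => fy gy [fy0|gy0].
  have yE : y = (1 - g y) *: P i + g y *: P (ord_pred i).
    have := @line_param _ (P (ordS i)) (P i) (P (ord_pred i)) y.
    have -> : g y = orient (P (ordS i)) (P i) y / orient (P (ordS i)) (P i) (P (ord_pred i)).
      rewrite /g /side -mulf_div divff // mul1r.
      have orientN p q r : orient p q r = - orient q p r :> R.
        by rewrite /orient /cross /=; ring.
      rewrite [orient (P (ordS i)) _ y]orientN.
      rewrite [orient (P (ordS i)) _ (P (ord_pred i))]orientN.
      have -> : orient (P i) (P (ordS i)) (P (ord_pred i)) = turn P i.
        by rewrite /turn /orient /cross /=; ring.
      by rewrite invrN mulrNN.
    apply.
      move/eqP: fy0; rewrite mulf_eq0 (negPf c0) /= pE => /eqP fy0.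
      by move: fy0; rewrite /orient /cross /=; lra.
    have -> : orient (P (ordS i)) (P i) (P (ord_pred i)) = - turn P i.
      by rewrite /turn /orient /cross /=; ring.
    by rewrite oppr_eq0 turn_neq0.
  exists (ord_pred i) => //; exists (1 - g y); last by rewrite pE subKr addrC -yE.
  have g0 : 0 <= g y by rewrite divr_ge0 // ltW.
  rewrite /= in_itv/= gerBl g0 andbT subr_ge0.
  by apply: ltW; near: y.
have yE : y = (1 - f y) *: P i + f y *: P (ordS i).
  have -> : f y = orient (P (ord_pred i)) (P i) y / orient (P (ord_pred i)) (P i) (P (ordS i)).
    by rewrite /f /side -mulf_div divff // mul1r pE.
  apply: line_param; last exact: turn_neq0.
  by move/eqP: gy0; rewrite mulf_eq0 (negPf c0) /= => /eqP.
have f0 : 0 <= f y by rewrite divr_ge0 // ltW.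
exists i => //; exists (f y) => //; rewrite /= in_itv/= f0.
by apply: ltW; near: y.
Unshelve. all: end_near. Qed.

(** The convex sector at the vertex [i] and the complement of its closure, when
[c] has the sign of the turn. *)
Definition in_sector c i y := 0 < side c P (ord_pred i) y /\ 0 < side c P i y.
Definition in_reflex c i y := side c P (ord_pred i) y < 0 \/ side c P i y < 0.

Let bisector i := (P (ordS i) - P i) + (P (ord_pred i) - P i).

Lemma side_bisector c i t :
  side c P (ord_pred i) (P i + t *: bisector i) = t * (c * turn P i) /\
  side c P i (P i + t *: bisector i) = t * (c * turn P i).
Proof.
by rewrite /side ord_predK /bisector /turn /orient /cross /= /GRing.scale /=; split; ring.
Qed.

(** The sector is connected, and the inner angle being below pi puts the points of
its bisector inside. *)
Lemma near_vertex_sector c i : 0 < c * turn P i ->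
  \forall y \near P i, in_sector c i y -> inside P y.
Proof.
move=> ci; have /nbhs_ballP [e /= e0 Ve] := near_vertex_boundary ci.
have VV := nbhsx_ballx (P i) e e0.
pose C := ball (P i) e `&` ([set y | 0 < side c P (ord_pred i) y] `&` [set y | 0 < side c P i y]).
have cC : connected C.
  apply: connected_seg_convex; apply: seg_convexI; first exact: seg_convex_ball.
  by apply: seg_convexI; exact: seg_convex_gt.
have Cb : C `<=` ~` boundary P.
  by move=> y [/Ve yb [/= y0 y1]] /yb [_ _ [y2|y2]]; rewrite y2 ltxx in y0 y1.
have [t [t0 [tP tV]]] : exists t, 0 < t /\
    (inside P (P i + t *: bisector i) /\ ball (P i) e (P i + t *: bisector i)).
  apply: (@filter_ex _ (0 : R)^'+); apply: filterI; first exact: nbhs_right_gt.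
  apply: filterI; first by have [_] := convex_vertex n_ge3 sP cP i.
  exact: near_shift VV.
have Ct : C (P i + t *: bisector i).
  by split=> //=; have [-> ->] := side_bisector c i t; rewrite mulr_gt0.
apply: filterS VV => y yV [y0 y1]; exact: (inside_connected cC Cb Ct _ tP).
Qed.

(** Near the vertex the reflex sector is the union of two half balls that meet, so
it is connected. *)
Lemma near_vertex_reflex c i : 0 < c * turn P i ->
  (\forall y \near P i, in_reflex c i y -> inside P y) \/
  (\forall y \near P i, in_reflex c i y -> ~ inside P y).
Proof.
move=> ci; have /nbhs_ballP [e /= e0 Ve] := near_vertex_boundary ci.
have VV := nbhsx_ballx (P i) e e0.
pose C j := ball (P i) e `&` [set y | 0 < side (- c) P j y].
have CE j y : 0 < side (- c) P j y = (side c P j y < 0).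
  by rewrite /side mulNr oppr_gt0.
have cC j : connected (C j).
  apply: connected_seg_convex; apply: seg_convexI; first exact: seg_convex_ball.
  exact: seg_convex_gt.
have [t [t0 tV]] : exists t, 0 < t /\ ball (P i) e (P i + t *: (- bisector i)).
  apply: (@filter_ex _ (0 : R)^'+); apply: filterI; first exact: nbhs_right_gt.
  exact: near_shift VV.
have cD : connected (C (ord_pred i) `|` C i).
  apply: connectedU => //; exists (P i + t *: (- bisector i)).
  rewrite /C /= !CE scalerN -scaleNr; rewrite scalerN -scaleNr in tV.
  by have [-> ->] := side_bisector c i (- t); rewrite mulNr oppr_lt0 mulr_gt0.
have Db : C (ord_pred i) `|` C i `<=` ~` boundary P.
  move=> y [[/Ve yb /=]|[/Ve yb /=]]; rewrite CE => y0 /yb [f0 g0 _].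
    by rewrite leNgt y0 in f0.
  by rewrite leNgt y0 in g0.
have reflexE y : ball (P i) e y -> in_reflex c i y -> (C (ord_pred i) `|` C i) y.
  by move=> yV [y0|y0]; [left|right]; split=> //=; rewrite CE.
have [[z [Dz Pz]]|nz] := pselect (exists z, (C (ord_pred i) `|` C i) z /\ inside P z).
  left; apply: filterS VV => y yV /(reflexE y yV) Dy.
  exact: (inside_connected cD Db Dz Dy Pz).
right; apply: filterS VV => y yV /(reflexE y yV) Dy Py; apply: nz; by exists y.
Qed.

Let near_near (Q : plane R -> Prop) x : (\forall y \near x, Q y) ->
  \forall z \near x, \forall y \near z, Q y.
Proof. exact: near_join. Qed.

(** This transports information from a vertex to its two edges: near such a point
[x] of one edge, the [side] of the other edge is positive, so that the sectors
at the vertex are told apart by the [side] of the first edge alone. *)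
Lemma open_edge_near_vertex c i (Q : plane R -> Prop) : 0 < c * turn P i ->
  (\forall y \near P i, Q y) ->
  (exists2 x, open_edge P i x & \forall y \near x, Q y /\ 0 < side c P (ord_pred i) y) /\
  (exists2 x, open_edge P (ord_pred i) x & \forall y \near x, Q y /\ 0 < side c P i y).
Proof.
move=> ci /near_near VQ.
have pE : P (ordS (ord_pred i)) = P i by rewrite ord_predK.
have aux (p : plane R) : exists t, 0 < t /\ (t < 1 /\
    \forall y \near (P i + t *: (p - P i)), Q y).
  apply: (@filter_ex _ (0 : R)^'+); apply: filterI; first exact: nbhs_right_gt.
  by apply: filterI; [exact: nbhs_right_lt|exact: near_shift VQ].
have conv t (p q : plane R) : p + t *: (q - p) = (1 - t) *: p + t *: q.
  by rewrite scalerBr scalerBl scale1r addrA addrAC.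
split.
  have [t [t0 [t1 tQ]]] := aux (P (ordS i)); rewrite conv in tQ.
  exists ((1 - t) *: P i + t *: P (ordS i)); first by exists t; rewrite ?t0.
  apply: filterI => //; apply: (near_gt0 (@continuous_side _ _ c P (ord_pred i) _)).
  by rewrite side_conv -{1}pE side_right mulr0 add0r side_pred_turn mulr_gt0.
have [t [t0 [t1 tQ]]] := aux (P (ord_pred i)); rewrite conv in tQ.
exists ((1 - t) *: P i + t *: P (ord_pred i)).
  exists (1 - t); first by rewrite subr_gt0 t1 gtrBl.
  by rewrite subKr pE addrC.
apply: filterI => //; apply: (near_gt0 (@continuous_side _ _ c P i _)).
by rewrite side_conv side_left mulr0 add0r side_next_turn mulr_gt0.
Qed.

End Vertices.

(** * From convex angles to strictly convex position *)

Section Global.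
Context {R : realType} {n : nat}.
Variable P : 'I_n -> plane R.
Hypothesis n_ge3 : (3 <= n)%N.
Hypothesis sP : simple_polygon P.
Hypothesis cP : convex_polygon P.
Implicit Types (i j : 'I_n) (x y : plane R) (c : R).

Let Pinj : injective P. Proof. by case: sP. Qed.

Definition reflex_outside c i := 0 < c * turn P i /\
  \forall y \near P i, in_reflex P c i y -> ~ inside P y.

Let sideN c i y : (0 < side (- c) P i y) = (side c P i y < 0).
Proof. by rewrite /side mulNr oppr_gt0. Qed.

(** At a leftmost vertex the horizontal ray to the left starts in the reflex
sector, for neither edge leads to the left, and never meets the curve. *)
Lemma leftmost_reflex_outside : exists c i, reflex_outside c i.
Proof.
pose i0 : 'I_n := Ordinal (ltn_trans (isT : (0 < 2)%N) n_ge3).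
case: (@Order.TotalTheory.arg_minP _ _ _ i0 predT (fun j => (P j).1)) => // i _ imin.
exists (turn P i), i.
have ci : 0 < turn P i * turn P i by rewrite -expr2 exprn_even_gt0 //= turn_neq0.
split=> //; have [Vin|//] := near_vertex_reflex sP ci; exfalso.
pose v : plane R := (- 1, 0).
have v0 : v != 0 by rewrite -pair_eqE /= oppr_eq0 oner_eq0.
have [t [t0 tV]] : exists t, 0 < t /\
    (in_reflex P (turn P i) i (P i + t *: v) -> inside P (P i + t *: v)).
  apply: (@filter_ex _ (0 : R)^'+); apply: filterI; first exact: nbhs_right_gt.
  exact: near_shift Vin.
suff : ~ inside P (P i + t *: v).
  (* Outside the reflex sector the two sides would be nonnegative, and the
     displacement [t *: v] a nonnegative combination of the two edges. *)
  apply; apply: tV; apply: contrapT => /not_orP [/negP]; rewrite -leNgt => f0 /negP.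
  rewrite -leNgt => g0.
  have : turn P i * turn P i * - t =
    side (turn P i) P (ord_pred i) (P i + t *: v) * ((P (ordS i)).1 - (P i).1) +
    side (turn P i) P i (P i + t *: v) * ((P (ord_pred i)).1 - (P i).1).
    by rewrite /side ord_predK /turn /orient /cross /v /= /GRing.scale /=; ring.
  apply/eqP; rewrite lt_eqF // (@lt_le_trans _ _ 0) //.
    by rewrite mulrN oppr_lt0 mulr_gt0.
  by rewrite addr_ge0 // mulr_ge0 // subr_ge0 imin.
apply: (ray_not_inside v0) => s s0 [j _ [r /= /itvP r01]].
move=> /(congr1 fst) /= E.
have r0 : 0 <= r by rewrite r01.
have r1 : r <= 1 by rewrite r01.
have := imin j isT; have := imin (ordS j) isT.
move: E; rewrite /GRing.scale /=; nra.
Qed.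

(** The side of the edge [i] where [side c] is negative is outside. At the next
vertex it belongs to the convex sector if the turn there has the other sign,
which is impossible as that sector is inside; otherwise it belongs to the
reflex sector. *)
Lemma reflex_outside_next c i : reflex_outside c i -> reflex_outside c (ordS i).
Proof.
move=> [ci Vout].
have c0 : c != 0 by apply: contraTneq ci => ->; rewrite mul0r ltxx.
have [[x xi xout] _] := open_edge_near_vertex ci Vout.
have {}xout : outer_side P (- c) i x.
  by apply: filterS xout => y [yout _]; rewrite sideN => yi; apply: yout; right.
have only_outer x' : open_edge P i x' -> ~ inner_side P (- c) i x'.
  move=> x'i x'in; apply: (side_not_both n_ge3 sP _ xi _ xout); first by rewrite oppr_eq0.
  by apply: inner_side_edge x'i xi x'in; rewrite ?oppr_eq0.
have := turn_neq0 n_ge3 sP cP (ordS i).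
have [ci'|ci'|/eqP] := ltrgtP (c * turn P (ordS i)) 0; last first.
- by rewrite mulf_eq0 (negPf c0) => /= ->.
- move=> _; split=> //.
  have [Vin|//] := near_vertex_reflex sP ci'; exfalso.
  have [_ [x' x'i x'in]] := open_edge_near_vertex ci' Vin.
  rewrite ordSK in x'i; apply: (only_outer x' x'i).
  apply: filterS x'in => y [yin _]; rewrite sideN => yi; apply: yin; left.
  by rewrite ordSK.
- rewrite -oppr_gt0 -mulNr in ci' => _; exfalso.
  have [_ [x' x'i x'in]] := open_edge_near_vertex ci'
    (near_vertex_sector n_ge3 sP cP ci').
  rewrite ordSK in x'i; apply: (only_outer x' x'i).
  by apply: filterS x'in => y [yin yS] yi; apply: yin; split; rewrite ?ordSK.
Qed.

Lemma ex_orientation : exists c, forall i, reflex_outside c i.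
Proof.
have [c [i ci]] := leftmost_reflex_outside; exists c.
by apply: ord_cyclic_ind ci _ => j; exact: reflex_outside_next.
Qed.

Variable c : R.
Hypothesis c_outside : forall i, reflex_outside c i.

Let c_turn i : 0 < c * turn P i. Proof. by have [] := c_outside i. Qed.

Let c0 : c != 0.
Proof.
pose i0 : 'I_n := Ordinal (ltn_trans (isT : (0 < 2)%N) n_ge3).
by apply: contraTneq (c_turn i0) => ->; rewrite mul0r ltxx.
Qed.

Lemma filled_near_vertex i : \forall y \near P i,
  filled P y <-> 0 <= side c P (ord_pred i) y /\ 0 <= side c P i y.
Proof.
have [ci Vout] := c_outside i.
have Vin := near_vertex_sector n_ge3 sP cP ci.
have Vb := near_vertex_boundary sP ci.
have Vs := near_vertex_boundary_of_side n_ge3 sP cP ci.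
near=> y.
have yin : in_sector P c i y -> inside P y by near: y.
have yout : in_reflex P c i y -> ~ inside P y by near: y.
have yb : boundary P y -> [/\ 0 <= side c P (ord_pred i) y, 0 <= side c P i y &
    side c P (ord_pred i) y = 0 \/ side c P i y = 0] by near: y.
have ys : 0 <= side c P (ord_pred i) y -> 0 <= side c P i y ->
    side c P (ord_pred i) y = 0 \/ side c P i y = 0 -> boundary P y by near: y.
split=> [[Py|/yb[]//]|[f0 g0]].
  by split; rewrite leNgt; apply/negP => y0; apply: yout Py; [left|right].
have [fE|f_neq0] := eqVneq (side c P (ord_pred i) y) 0; first by right; apply: ys => //; left.
have [gE|g_neq0] := eqVneq (side c P i y) 0; first by right; apply: ys => //; right.
by left; apply: yin; split; rewrite lt_def ?f0 ?g0 ?f_neq0 ?g_neq0.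
Unshelve. all: end_near. Qed.

Lemma filled_near_open_edge i x : open_edge P i x -> \forall y \near x,
  filled P y <-> 0 <= side c P i y.
Proof.
move=> xi; have [ci Vout] := c_outside i.
have xin : inner_side P c i x.
  have [[x' x'i x'in] _] := open_edge_near_vertex ci (near_vertex_sector n_ge3 sP cP ci).
  apply: inner_side_edge x'i xi _ => //.
  by apply: filterS x'in => y [yin yp] yi; apply: yin.
have xout : outer_side P (- c) i x.
  have nc0 : - c != 0 by rewrite oppr_eq0.
  have [x'in|//] := inner_or_outer n_ge3 sP (- c) xi.
  have [[x' x'i x'out] _] := open_edge_near_vertex ci Vout.
  exfalso; apply: (side_not_both n_ge3 sP nc0 x'i); first exact: inner_side_edge xi x'i x'in.
  by apply: filterS x'out => y [yout _]; rewrite sideN => yi; apply: yout; right.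
have xs := near_open_edge_boundary n_ge3 sP cP c0 xi.
have xb := near_open_edge_side n_ge3 sP c xi.
near=> y.
have yin : 0 < side c P i y -> inside P y by near: y.
have yout : 0 < side (- c) P i y -> ~ inside P y by near: y.
have ys : side c P i y = 0 -> boundary P y by near: y.
have yb : boundary P y -> side c P i y = 0 by near: y.
split=> [[Py|/yb -> //]|].
  by rewrite leNgt; apply/negP => y0; apply: yout Py; rewrite sideN.
by rewrite le0r => /predU1P[/ys|/yin]; [right|left].
Unshelve. all: end_near. Qed.

Lemma edge_cases i x : edge P i x -> [\/ x = P i, x = P (ordS i) | open_edge P i x].
Proof.
move=> [t /= /itvP t01 <-].
have [->|t0] := eqVneq t 0.
  by constructor 1; rewrite subr0 scale1r scale0r addr0.
have [->|t1] := eqVneq t 1.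
  by constructor 2; rewrite subrr scale1r scale0r add0r.
by constructor 3; exists t => //; rewrite lt_def t0 lt_neqAle t1 !t01.
Qed.

Lemma filled_locally_convex x : filled P x ->
  exists2 e, 0 < e & seg_convex (filled P `&` ball x e).
Proof.
have half (A : set (plane R)) : seg_convex A ->
    (\forall y \near x, filled P y <-> A y) ->
    exists2 e, 0 < e & seg_convex (filled P `&` ball x e).
  move=> cA /nbhs_ballP [e e0 xe]; exists e => //.
  have -> : filled P `&` ball x e = A `&` ball x e.
    by apply/seteqP; split=> y [Ay yx]; split=> //; apply/(xe y yx).
  by apply: seg_convexI => //; exact: seg_convex_ball.
have vertex i : x = P i -> exists2 e, 0 < e & seg_convex (filled P `&` ball x e).
  move=> xi; apply: (half ([set y | 0 <= side c P (ord_pred i) y] `&` [set y | 0 <= side c P i y])).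
    by apply: seg_convexI; exact: seg_convex_ge.
  by rewrite xi; exact: filled_near_vertex.
case=> [Px|[i _ /edge_cases [/vertex//|/vertex//|xi]]].
  apply: (half setT) => //.
  by have := near_inside Px; apply: filterS => y Py; split=> // _; left.
apply: (half [set y | 0 <= side c P i y]); first exact: seg_convex_ge.
exact: filled_near_open_edge.
Qed.

Lemma filled_convex : seg_convex (filled P).
Proof.
apply: locally_convex_convex; [exact: compact_filled|exact: connected_filled|].
exact: filled_locally_convex.
Qed.

(** The segment from the middle of the edge to a point beyond its line would leave
the filled polygon at once. *)
Lemma filled_side_ge0 i y : filled P y -> 0 <= side c P i y.
Proof.
move=> Ky; pose m := (1 - 2^-1) *: P i + 2^-1 *: P (ordS i).
have mi : open_edge P i m by exists 2^-1; rewrite ?invr_gt0 ?invf_lt1 ?ltr0n ?ltr1n.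
have Km : filled P m by right; exists i => //; exact: open_edge_edge.
have [t [t0 [t1 tK]]] : exists t, 0 < t /\ (t < 1 /\
    (filled P (m + t *: (y - m)) <-> 0 <= side c P i (m + t *: (y - m)))).
  apply: (@filter_ex _ (0 : R)^'+); apply: filterI; first exact: nbhs_right_gt.
  apply: filterI; first exact: nbhs_right_lt.
  exact: (near_shift _ (filled_near_open_edge mi)).
have tE : m + t *: (y - m) = (1 - t) *: m + t *: y.
  by rewrite scalerBr scalerBl scale1r addrA addrAC.
move: tK; rewrite tE => -[tK _].
have : filled P ((1 - t) *: m + t *: y).
  by apply: (filled_convex Km Ky); exists t => //=; rewrite in_itv/= !ltW.
move=> /tK; rewrite side_conv (edge_side c (open_edge_edge mi)) mulr0 add0r.
by rewrite pmulr_rge0.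
Qed.

(** A vertex on the line of another edge would lie on that edge, between the two
neighbouring edges. *)
Lemma oriented_strictly_convex : strictly_convex c P.
Proof.
move=> i j ji jSi; have [_ _ sPP] := sP.
have Kj k : 0 <= side c P k (P j).
  by apply: filled_side_ge0; right; exists j => //; exact: segment_left.
rewrite lt_def Kj andbT; apply/eqP => jE.
have ij : edge P i (P j).
  apply: edge_between jE => //; first by rewrite side_pred_turn.
  by have := side_next_turn P c (ordS i); rewrite ordSK => ->.
rewrite eq_sym in ji.
have [[jS _]|[_ /Pinj jiE]] := sPP i j ji (P j) ij (segment_left _ _).
  by rewrite jS eqxx in jSi.
by rewrite jiE eqxx in ji.
Qed.

End Global.

Theorem convex_polygon_strictly_convex (R : realType) (n : nat) (P : 'I_n -> plane R) :
  simple_polygon P -> convex_polygon P -> exists c, strictly_convex c P.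
Proof.
move=> sP cP; have n_ge3 : (3 <= n)%N by case: sP.
have [c c_out] := ex_orientation n_ge3 sP cP.
by exists c; exact: oriented_strictly_convex c_out.
Qed.

(** * Counting vertices by parity *)

Section LatticePoints.
Context {R : realType}.
Implicit Types (z w : int * int) (p q : plane R).

Definition lattice_point z : plane R := (z.1%:~R, z.2%:~R).

Lemma lattice_lattice_point z : lattice (lattice_point z).
Proof. by split; exact: intr_int. Qed.

Lemma latticeP p : lattice p -> exists z, p = lattice_point z.
Proof.
move=> [/intrP[m pm] /intrP[k pk]]; exists (m, k).
by rewrite /lattice_point /= -pm -pk -surjective_pairing.
Qed.

Lemma lattice_point_inj : injective lattice_point.
Proof. by move=> [z1 z2] [w1 w2] [/intr_inj -> /intr_inj ->]. Qed.

Definition parity z : bool * bool := ((2 %| z.1)%Z, (2 %| z.2)%Z).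

Definition midpoint p q : plane R := 2^-1 *: (p + q).

Lemma midpointE p q : midpoint p q = (1 - 2^-1) *: p + 2^-1 *: q.
Proof. by apply/pair_equal_spec; rewrite /= /GRing.scale /=; split; field. Qed.

Lemma lattice_midpoint z w : parity z = parity w -> exists m,
  [/\ midpoint (lattice_point z) (lattice_point w) = lattice_point m,
      z.1 + w.1 = 2 * m.1 & z.2 + w.2 = 2 * m.2].
Proof.
case: z w => [z1 z2] [w1 w2] [/= p1 p2].
exists (((z1 + w1)%R %/ 2)%Z, ((z2 + w2)%R %/ 2)%Z) => /=.
have e1 : (z1 + w1 = 2 * ((z1 + w1)%R %/ 2)%Z)%R by lia.
have e2 : (z2 + w2 = 2 * ((z2 + w2)%R %/ 2)%Z)%R by lia.
split=> //; apply/pair_equal_spec; rewrite /= /GRing.scale /=.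
by rewrite -!intrD {1}e1 {1}e2 !intrM !mulrA !mulVf ?mul1r.
Qed.

(** Halving the distance of two points of equal parity cannot go on forever. *)
Lemma distinct_parities (A : set (plane R)) :
  (forall p q, A p -> A q -> A (midpoint p q)) ->
  forall z w, A (lattice_point z) -> A (lattice_point w) -> z != w ->
  exists z' w', [/\ A (lattice_point z'), A (lattice_point w') & parity z' != parity w'].
Proof.
move=> Amid z w.
move: {-1}(absz _ + absz _)%N (leqnn (absz (z.1 - w.1) + absz (z.2 - w.2))%N) => N.
elim: N => [|N IH] in w * => zw Az Aw neq.
  move: zw neq; case: z w {Az Aw} => [z1 z2] [w1 w2] /= zw.
  by rewrite -pair_eqE /=; lia.
have [pzw|pzw] := eqVneq (parity z) (parity w); last by exists z, w.
have [m [mE m1 m2]] := lattice_midpoint pzw.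
apply: (IH m) => //; last 2 first.
- by rewrite -mE; exact: Amid.
- apply: contraNneq neq => zm; apply/eqP; move: m1 m2; rewrite -zm.
  by case: z w {IH Az Aw pzw mE zw zm} => [z1 z2] [w1 w2] /= ? ?; congr pair; lia.
move: zw neq m1 m2; case: z w m {IH Az Aw pzw mE} => [z1 z2] [w1 w2] [m1 m2] /=.
by rewrite -pair_eqE /=; lia.
Qed.

End LatticePoints.

Section StrictlyConvexVertices.
Context {R : realType} {n : nat}.
Variables (c : R) (P : 'I_n -> plane R).
Hypothesis n_ge3 : (3 <= n)%N.
Hypothesis scP : strictly_convex c P.
Implicit Types (i j k : 'I_n) (p q : plane R).

(** At the vertex [k] the two adjacent [side] functions vanish, and being
nonnegative at the vertices they vanish at [P i] and [P j] too. *)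
Lemma vertex_extreme i j k t : 0 < t < 1 ->
  P k = (1 - t) *: P i + t *: P j -> i = k /\ j = k.
Proof.
move=> /andP[t0 t1] kE.
have zero l : side c P l (P k) = 0 -> side c P l (P i) = 0 /\ side c P l (P j) = 0.
  have t1' : 0 < 1 - t by rewrite subr_gt0.
  rewrite kE side_conv => /eqP; rewrite paddr_eq0; last 2 first.
  - by rewrite mulr_ge0 ?(ltW t1') // (side_ge0 scP).
  - by rewrite mulr_ge0 ?(ltW t0) // (side_ge0 scP).
  rewrite (mulf_eq0 (1 - t)) (mulf_eq0 t) (gt_eqF t1') (gt_eqF t0) /=.
  by move=> /andP[/eqP ? /eqP ?].
have vertex l m : side c P l (P m) = 0 -> m = l \/ m = ordS l.
  move=> lm; have [->|ml] := eqVneq m l; first by left.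
  have [->|mSl] := eqVneq m (ordS l); first by right.
  by have := scP ml mSl; rewrite lm ltxx.
have only m : side c P k (P m) = 0 -> side c P (ord_pred k) (P m) = 0 -> m = k.
  move=> /vertex [//|mS] /vertex []; rewrite ?ord_predK // => mp.
  by have := ordS_neq_pred n_ge3 k; rewrite -mS -mp eqxx.
have pE : P (ordS (ord_pred k)) = P k by rewrite ord_predK.
have [ki kj] := zero k (side_left c P k).
have [pi pj] : side c P (ord_pred k) (P i) = 0 /\ side c P (ord_pred k) (P j) = 0.
  by apply: zero; rewrite -pE side_right.
by split; exact: only.
Qed.

(** One of three points on a line lies between the two others. *)
Lemma no_three_collinear i j k : i != j -> j != k -> k != i ->
  orient (P i) (P j) (P k) != 0.
Proof.
move=> ij jk ki; apply/eqP => ijk.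
have Pij : P j - P i != 0.
  by rewrite subr_eq0 (inj_eq (strictly_convex_inj n_ge3 scP)) eq_sym.
have := parallel_scale Pij ijk; set s := _ / _ => kE.
have {}kE : P k = (1 - s) *: P i + s *: P j.
  rewrite -[P k](subrK (P i)) kE.
  by apply/pair_equal_spec; rewrite /= /GRing.scale /=; split; ring.
have [s0|s0|s0] := ltrgtP s 0.
- have [||/eqP] := @vertex_extreme k j i (s / (s - 1)); last by rewrite (negPf ki).
    by apply/andP; split; [rewrite ltr_ndivlMr|rewrite ltr_ndivrMr]; lra.
  rewrite kE [LHS]surjective_pairing.
  apply/pair_equal_spec; rewrite /= /GRing.scale /=.
  by split; field; lra.
- have [s1|s1|s1] := ltrgtP s 1.
  + have [||/eqP] := @vertex_extreme i j k s; last by rewrite eq_sym (negPf ki).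
      by rewrite s0.
    exact: kE.
  + have [||/eqP] := @vertex_extreme i k j s^-1; last by rewrite (negPf ij).
      by rewrite invr_gt0 s0 invf_lt1.
    rewrite kE [LHS]surjective_pairing.
  apply/pair_equal_spec; rewrite /= /GRing.scale /=.
    by split; field; lra.
  + move: kE; rewrite s1 subrr scale0r add0r scale1r.
    by move=> /(strictly_convex_inj n_ge3 scP) /eqP; rewrite eq_sym (negPf jk).
- move: kE; rewrite s0 subr0 scale0r addr0 scale1r.
  by move=> /(strictly_convex_inj n_ge3 scP) /eqP; rewrite (negPf ki).
Qed.

Lemma inside_midpoint p q : inside P p -> (forall j, 0 <= side c P j q) ->
  inside P (midpoint p q).
Proof.
move=> /(inside_strictly_convexP n_ge3 scP) p0 q0.
apply/(inside_strictly_convexP n_ge3 scP) => j; rewrite midpointE side_conv.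
by have := p0 j; have := q0 j; lra.
Qed.

Section Counting.
Variable Q : 'I_n -> int * int.
Hypothesis PQ : forall i, P i = lattice_point (Q i).
Hypothesis bP : boundary_lattice_points P `<=` range P.
Variables (a b d : R).
Hypothesis line : forall p, interior_lattice_points P p -> a * p.1 + b * p.2 = d.
Variables z w : int * int.
Hypotheses (Pz : inside P (lattice_point z)) (Pw : inside P (lattice_point w)).
Hypothesis zw : parity z != parity w.

Let level p := a * p.1 + b * p.2 - d.

Let level_mid p q : level (midpoint p q) = 2^-1 * (level p + level q).
Proof. by rewrite /level /midpoint /= /GRing.scale /=; field. Qed.

Let level_inside m : inside P (lattice_point m) -> level (lattice_point m) = 0.
Proof.
move=> Pm; apply/eqP; rewrite subr_eq0; apply/eqP/line.
by split=> //; exact: lattice_lattice_point.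
Qed.

(** Otherwise the midpoint would be an inner lattice point off the line. *)
Let parity_off_line i u : inside P (lattice_point u) -> level (P i) != 0 ->
  parity (Q i) != parity u.
Proof.
move=> Pu Li; apply: contraNneq Li => /esym /(@lattice_midpoint R) [m [mE _ _]].
have : inside P (lattice_point m).
  rewrite -mE; apply: inside_midpoint => // j; rewrite -PQ; exact: side_ge0.
move=> /level_inside; rewrite -mE level_mid level_inside // add0r -PQ.
by move=> /eqP; rewrite mulf_eq0 invr_eq0 pnatr_eq0.
Qed.

(** Otherwise the midpoint would be a lattice point off the line. If it were a
boundary point it would be a vertex, against [vertex_extreme]. *)
Let parity_same_side (e : R) i j : 0 < e * level (P i) -> 0 < e * level (P j) ->
  parity (Q i) = parity (Q j) -> i = j.
Proof.
move=> Li Lj /(@lattice_midpoint R) [m [mE _ _]]; rewrite -!PQ in mE.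
have m_ge0 k : 0 <= side c P k (lattice_point m).
  rewrite -mE midpointE side_conv.
  by have := side_ge0 scP k i; have := side_ge0 scP k j; lra.
have [bm|nbm] := pselect (boundary P (lattice_point m)).
  have [k _] : range P (lattice_point m).
    by apply: bP; split=> //; exact: lattice_lattice_point.
  rewrite -mE midpointE => /vertex_extreme [|-> -> //].
  by rewrite invr_gt0 ltr0n invf_lt1 ?ltr1n.
have : inside P (lattice_point m).
  apply/(inside_strictly_convexP n_ge3 scP) => k; rewrite lt_def m_ge0 andbT.
  apply/eqP => mk; apply: nbm; apply/(boundary_strictly_convexP n_ge3 scP).
  by split=> //; exists k.
move=> /level_inside; rewrite -mE level_mid => L0; exfalso.
have : e * (level (P i) + level (P j)) = 0.
  by move/eqP: L0; rewrite mulf_eq0 invr_eq0 pnatr_eq0 /= => /eqP ->; rewrite mulr0.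
by rewrite mulrDr; lra.
Qed.

(** Of the four parity classes, those of [z] and [w] are excluded. *)
Lemma card_open_half_plane (e : R) : (#|[set i | (0 < e * level (P i))%R]%SET| <= 2)%N.
Proof.
set A := [set i | _]%SET.
have AE i : i \in A = (0 < e * level (P i)) by rewrite inE.
rewrite -(card_in_imset (f := fun i => parity (Q i))); last first.
  by move=> i j; rewrite !AE; exact: parity_same_side.
apply: leq_trans (subset_leq_card (_ : _ \subset ~: [set parity z; parity w]%SET)) _.
  apply/fintype.subsetP => _ /imsetP [i iA ->]; rewrite !inE negb_or.
  have Li : level (P i) != 0.
    by rewrite AE in iA; apply: contraTneq iA => ->; rewrite mulr0 ltxx.
  by rewrite !parity_off_line.
by rewrite cardsCs finset.setCK card_prod card_bool cards2 zw.
Qed.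

Lemma card_vertices_le6 : (a, b) <> (0, 0) -> (n <= 6)%N.
Proof.
move=> ab.
have card0 : (#|[set i | level (P i) == 0%R]%SET| <= 2)%N.
  rewrite leqNgt; apply/negP => /card_gt2P [i [j [k []]]].
  rewrite !inE => -[/eqP Li /eqP Lj /eqP Lk] [ij jk ki].
  have := no_three_collinear ij jk ki; apply/negP; rewrite negbK.
  have E p q : level p = 0 -> level q = 0 -> a * (q - p).1 + b * (q - p).2 = 0.
    by rewrite /level /= => pE qE; lra.
  apply/eqP; have := E _ _ Li Lj; have := E _ _ Li Lk; rewrite /orient.
  move: (P j - P i) (P k - P i) => u v Ev Eu.
  have a0 : a * cross u v = (a * u.1 + b * u.2) * v.2 - u.2 * (a * v.1 + b * v.2).
    by rewrite /cross; ring.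
  have b0 : b * cross u v = u.1 * (a * v.1 + b * v.2) - v.1 * (a * u.1 + b * u.2).
    by rewrite /cross; ring.
  rewrite Eu Ev !(mul0r, mulr0) subr0 in a0 b0.
  apply/eqP; apply: contra_notT ab => uv.
  by move/eqP: a0; move/eqP: b0; rewrite !mulf_eq0 (negPf uv) !orbF => /eqP -> /eqP ->.
have -> : n = #|[set: 'I_n]%SET| by rewrite cardsT card_ord.
have -> : [set: 'I_n]%SET = ([set i | (0 < 1 * level (P i))%R] :|:
    [set i | (0 < -1 * level (P i))%R] :|: [set i | level (P i) == 0%R])%SET.
  apply/setP => i; rewrite !inE mul1r mulN1r oppr_gt0.
  by case: ltrgtP.
apply: leq_trans (leq_card_setU _ _) _; apply: (@leq_add _ _ 4 2) => //.
apply: leq_trans (leq_card_setU _ _) _.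
by apply: (@leq_add _ _ 2 2); exact: card_open_half_plane.
Qed.

End Counting.

End StrictlyConvexVertices.

Section Cardinality.

Lemma card_II_range (T : Type) (A : set T) n (f : 'I_n -> T) :
  injective f -> (forall i, A (f i)) -> A #= `I_n -> A `<=` range f.
Proof.
move=> fI Af /card_set_bijP [g [gA gI _]] x Ax.
have gf i : (g (f i) < n)%N by exact: gA.
have hI : injective (fun i => Ordinal (gf i)).
  by move=> i j [gij]; apply: fI; apply: gI => //; rewrite inE.
have [h' _ h'K] := injF_bij hI.
have gx : (g x < n)%N by exact: gA.
exists (h' (Ordinal gx)) => //; apply: gI; rewrite ?inE //.
by have /(congr1 val) := h'K (Ordinal gx).
Qed.

Lemma card_II_two (T : Type) (A : set T) k : (2 <= k)%N -> A #= `I_k ->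
  exists x y, [/\ A x, A y & x <> y].
Proof.
move=> k2 /card_set_bijP [g [_ _ gS]].
have [x Ax gx] := gS 0%N (ltn_trans (ltn0Sn 0) k2).
have [y Ay gy] := gS 1%N k2.
by exists x, y; split=> // xy; move: gx; rewrite xy gy.
Qed.

Lemma card_II_image (T : Type) n (f : 'I_n -> T) : injective f -> range f #= `I_n.
Proof.
move=> fI; apply: (card_eq_trans (inj_card_eq _) (card_esym card_II)).
by move=> i j _ _; exact: fI.
Qed.

End Cardinality.

Theorem card_collinear_le6 (R : realType) (k n : nat) (P : 'I_n -> plane R) :
  (2 <= k)%N -> lattice_polygon P -> convex_polygon P ->
  boundary_lattice_points P #= `I_n -> interior_lattice_points P #= `I_k ->
  collinear (interior_lattice_points P) -> (n <= 6)%N.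
Proof.
move=> k2 [sP lP] cP bn ik [a [b [d [ab line]]]].
have [n_ge3 Pinj _] := sP.
have [c scP] := convex_polygon_strictly_convex sP cP.
have [Q PQ] : exists Q : 'I_n -> int * int, forall i, P i = lattice_point (Q i).
  have H i : exists z, P i = lattice_point z by exact: latticeP.
  by have [Q PQ] := choice H; exists Q.
have bP : boundary_lattice_points P `<=` range P.
  apply: card_II_range bn => // i; split; last exact: lP.
  by exists i => //; exact: segment_left.
have [x [y [[Px /latticeP [x' xE]] [Py /latticeP [y' yE]] xy]]] := card_II_two k2 ik.
have Pmid p q : inside P p -> inside P q -> inside P (midpoint p q).
  move=> Pp Pq; apply: (inside_midpoint n_ge3 scP) => // j.
  by apply/ltW; move: j; apply/(inside_strictly_convexP n_ge3 scP).
have [|||z [w [Pz Pw zw]]] := distinct_parities Pmid (z := x') (w := y').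
- by rewrite -xE.
- by rewrite -yE.
- by apply/eqP => x'y'; apply: xy; rewrite xE yE x'y'.
exact: (card_vertices_le6 n_ge3 scP PQ bP line Pz Pw zw ab).
Qed.

(** * Lattice polygons of each size *)

Definition int_orient (z w v : int * int) : int :=
  (w.1 - z.1) * (v.2 - z.2) - (w.2 - z.2) * (v.1 - z.1).

Lemma orient_lattice_point (R : realType) z w v :
  orient (lattice_point z) (lattice_point w) (lattice_point v) = (int_orient z w v)%:~R :> R.
Proof.
by rewrite /orient /cross /int_orient /lattice_point /= !(rmorphM, rmorphB) /=.
Qed.

(** The properties of a lattice polygon with inner points (1,0), ..., (k,0) amount
to finitely many statements about integers. *)
Section LatticeExamples.
Context {R : realType} {k : nat}.
Variable s : seq (int * int).
Let n := size s.
Hypothesis n_ge3 : (3 <= n)%N.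
Let q (i : nat) : int * int := nth (0, 0) s i.
Hypothesis convex_s : forall i j, (i < n)%N -> (j < n)%N -> j != i -> j != (i.+1 %% n)%N ->
  0 < int_orient (q i) (q (i.+1 %% n)%N) (q j).
(** By Bezout, the edges have no lattice points except for their ends. *)
Hypothesis primitive_s : forall i, (i < n)%N -> exists u v : int,
  u * ((q (i.+1 %% n)%N).1 - (q i).1) + v * ((q (i.+1 %% n)%N).2 - (q i).2) = 1.
Hypothesis inside_s : forall x y : int,
  (forall i, (i < n)%N -> 0 < int_orient (q i) (q (i.+1 %% n)%N) (x, y)) <->
  y = 0 /\ 0 < x <= k%:Z.

Let P (i : 'I_n) : plane R := lattice_point (q i).

Let scP : strictly_convex 1 P.
Proof.
move=> i j ji jSi; rewrite /side mul1r orient_lattice_point ltr0z.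
exact: convex_s.
Qed.

(** The coefficients of [primitive_s] show that the parameter of a lattice point on
an edge is an integer. *)
Let boundary_range : boundary_lattice_points P = range P.
Proof.
apply/seteqP; split=> [x [[i _ [t /= /itvP t01 tx]] /latticeP [z xz]]|x [i _ <-]]; last first.
  by split; [exists i => //; exact: segment_left|exact: lattice_lattice_point].
have [u [v uv]] := primitive_s (ltn_ord i).
have tE : t = (u * (z.1 - (q i).1) + v * (z.2 - (q i).2))%:~R.
  rewrite xz in tx; have /= tx1 := congr1 fst tx; have /= tx2 := congr1 snd tx.
  rewrite rmorphD !rmorphM !rmorphB /= -tx1 -tx2 /GRing.scale /=.
  have := congr1 (fun m => m%:~R : R) uv.
  rewrite /= rmorphD !rmorphM !rmorphB /= => uvR.
  by rewrite -[LHS]mulr1 -[1 in LHS]/(1%:~R) -uvR; ring.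
have [t0|t1] : t = 0 \/ t = 1.
  have := t01; rewrite tE; set m := (_ + _)%R => m01.
  have m0 : 0 <= m by rewrite -(ler0z R) m01.
  have m1 : m <= 1 by rewrite -(ler_int R) m01.
  have [->|->] : m = 0 \/ m = 1 by lia.
    by left.
  by right.
- by exists i => //; rewrite -tx t0 subr0 scale1r scale0r addr0.
- by exists (ordS i) => //; rewrite -tx t1 subrr scale1r scale0r add0r.
Qed.

Let interior_range : interior_lattice_points P =
  (fun m : nat => lattice_point (m.+1%:Z, 0)) @` `I_k.
Proof.
have insideE x y : inside P (lattice_point (x, y)) <-> y = 0 /\ 0 < x <= k%:Z.
  rewrite -inside_s; split=> [/(inside_strictly_convexP n_ge3 scP) H i ni|H].
    by have := H (Ordinal ni); rewrite /side mul1r orient_lattice_point ltr0z.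
  apply/(inside_strictly_convexP n_ge3 scP) => i.
  by rewrite /side mul1r orient_lattice_point ltr0z; exact: H.
apply/seteqP; split=> [p [Pp /latticeP [[x y] pE]]|_ [m /= mk <-]].
  rewrite pE in Pp *; have [-> /andP[x0 xk]] := (insideE x y).1 Pp.
  exists (absz x).-1; first by rewrite /=; lia.
  by congr (lattice_point (_, _)); lia.
split; last exact: lattice_lattice_point.
by apply/insideE; split=> //; lia.
Qed.

Lemma lattice_example : exists P : 'I_n -> plane R,
  [/\ lattice_polygon P, convex_polygon P,
      boundary_lattice_points P #= `I_n, interior_lattice_points P #= `I_k &
      collinear (interior_lattice_points P)].
Proof.
exists P; split.
- split; first exact: strictly_convex_simple scP.
  by move=> i; exact: lattice_lattice_point.
- exact: strictly_convex_polygon scP.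
- rewrite boundary_range; apply: card_II_image.
  exact: strictly_convex_inj scP.
- rewrite interior_range; apply: inj_card_eq => m m' _ _ /lattice_point_inj [].
  by [].
- exists 0, 1, 0; split; first by move=> [/eqP]; rewrite oner_eq0.
  by rewrite interior_range => _ [m _ <-] /=; rewrite mul0r mul1r addr0.
Qed.

End LatticeExamples.

Ltac split_index := case=> [|[|[|[|[|[|?]]]]]]; try by [].

Ltac unimodular_edge :=
  by [exists 0, 1; lia|exists 0, (-1); lia|exists 1, 0; lia|exists (-1), 0; lia].

(** In each case the inner points have height strictly between -1 and 1, as all
vertices have height -1, 0 or 1. *)
Lemma example_of_each_size (R : realType) (k n : nat) : (3 <= k)%N ->
  n \in [:: 3; 4; 5; 6]%N -> exists P : 'I_n -> plane R,
  [/\ lattice_polygon P, convex_polygon P,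
      boundary_lattice_points P #= `I_n, interior_lattice_points P #= `I_k &
      collinear (interior_lattice_points P)].
Proof.
move=> k3; rewrite !inE => /or4P[] /eqP ->.
- apply: (@lattice_example R k [:: (0, 0); (0, -1); (2 * k%:Z + 1, 1)]) => //.
  + by split_index; split_index; rewrite /int_orient /=; lia.
  + split_index => _ /=; [exists 0, (-1)|exists 1, (- k%:Z)|exists 0, (-1)]; lia.
  + move=> x y; split=> [H|[-> x0]]; last first.
      by split_index => _; rewrite /int_orient /=; lia.
    have := H 0%N isT; have := H 1%N isT; have := H 2%N isT; rewrite /int_orient /=.
    move=> h2 h1 h0; have y0 : y = 0 by nia.
    by rewrite y0 in h0 h1 h2 *; split=> //; lia.
- apply: (@lattice_example R k [:: (0, 0); (1, -1); (k%:Z + 1, 0); (1, 1)]) => //.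
  + by split_index; split_index; rewrite /int_orient /=; lia.
  + by split_index => _ /=; unimodular_edge.
  + move=> x y; split=> [H|[-> x0]]; last first.
      by split_index => _; rewrite /int_orient /=; lia.
    have := H 0%N isT; have := H 1%N isT; have := H 2%N isT; have := H 3%N isT.
    rewrite /int_orient /= => h3 h2 h1 h0; have y0 : y = 0 by nia.
    by rewrite y0 in h0 h1 h2 h3 *; split=> //; lia.
- apply: (@lattice_example R k
    [:: (0, 0); (1, -1); (k%:Z + 1, 0); (2, 1); (1, 1)]) => //.
  + by split_index; split_index; rewrite /int_orient /=; lia.
  + by split_index => _ /=; unimodular_edge.
  + move=> x y; split=> [H|[-> x0]]; last first.
      by split_index => _; rewrite /int_orient /=; lia.
    have := H 0%N isT; have := H 1%N isT; have := H 2%N isT; have := H 3%N isT.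
    have := H 4%N isT; rewrite /int_orient /= => h4 h3 h2 h1 h0.
    have y0 : y = 0 by nia.
    by rewrite y0 in h0 h1 h2 h3 h4 *; split=> //; lia.
- apply: (@lattice_example R k
    [:: (0, 0); (1, -1); (2, -1); (k%:Z + 1, 0); (2, 1); (1, 1)]) => //.
  + by split_index; split_index; rewrite /int_orient /=; lia.
  + by split_index => _ /=; unimodular_edge.
  + move=> x y; split=> [H|[-> x0]]; last first.
      by split_index => _; rewrite /int_orient /=; lia.
    have := H 0%N isT; have := H 1%N isT; have := H 2%N isT; have := H 3%N isT.
    have := H 4%N isT; have := H 5%N isT; rewrite /int_orient /=.
    move=> h5 h4 h3 h2 h1 h0; have y0 : y = 0 by lia.
    by rewrite y0 in h0 h1 h2 h3 h4 h5 *; split=> //; lia.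
Qed.

Theorem theorem8 (R : realType) (k n : nat) (hk : (3 <= k)%N) :
  (exists P : 'I_n -> plane R,
     [/\ lattice_polygon P,
         convex_polygon P,
         boundary_lattice_points P #= `I_n,
         interior_lattice_points P #= `I_k &
         collinear (interior_lattice_points P)])
  <-> n \in [:: 3; 4; 5; 6]%N.
Proof.
split=> [[P [lP cP bn ik colP]]|]; last exact: example_of_each_size.
have := card_collinear_le6 (ltnW hk) lP cP bn ik colP.
have [[n3 _ _] _] := lP.
by case: n n3 {P lP cP bn ik colP} => [|[|[|[|[|[|[|n]]]]]]].
Qed.
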